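(* The restriction of $\overline{j}$ to $\pi(\mathfrak{C})\setminus S$ defines a holomorphic covering space of degree $4$ over $\mathbb{C}\setminus\{0,1728\}$.
   Context: A conic in $\mathbb{CP}^2$ is identified with its symmetric $3\times 3$ complex matrix up to a non-zero scalar. $\mathfrak{O}\subset\mathbb{CP}^5\times\mathbb{CP}^5$ is the open set of pairs $(C,D)$ of non-degenerate conics that intersect transversely, i.e. in four distinct points. $G=\mathbb{P}GL_3(\mathbb{C})$ acts on $\mathfrak{O}$ by congruence, $(C,D)\mapsto(A^TCA,A^TDA)$; $\mathcal{M}=\mathfrak{O}/G$ and $\pi:\mathfrak{O}\to\mathcal{M}$ is the canonical projection. Sending the orbit of $(C,D)$ to the class $[\lambda_1:\lambda_2:\lambda_3]$ of the three (distinct, non-zero) roots of $\det(tC+D)$ identifies $\mathcal{M}$ with the open subset $U/S_3$ of $\mathbb{CP}^2/S_3$, where $U\subset\mathbb{CP}^2$ is the set of points with distinct non-zero coordinates and $S_3$ permutes coordinates; $\mathcal{M}$ carries the complex structure of this quotient. The Cayley set $\mathfrak{C}\subset\mathfrak{O}$ is the set of $(C,D)\in\mathfrak{O}$ for which the coefficient $A_2$ of $t^2$ in the Taylor expansion of $\sqrt{\det(tC+D)}$ at $t=0$ vanishes; its image $\pi(\mathfrak{C})$ is the curve in $\mathcal{M}$ given by $-\lambda_1^2\lambda_2^2+2\lambda_1^2\lambda_2\lambda_3-\lambda_1^2\lambda_3^2+2\lambda_1\lambda_2^2\lambda_3+2\lambda_1\lambda_2\lambda_3^2-\lambda_2^2\lambda_3^2=0$.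 The function $\overline{j}:\mathcal{M}\to\mathbb{C}$ is $$\overline{j}(\lambda_1,\lambda_2,\lambda_3)=\frac{256(\lambda_1^2-\lambda_1\lambda_2-\lambda_1\lambda_3+\lambda_2^2-\lambda_2\lambda_3+\lambda_3^2)^3}{(\lambda_1-\lambda_2)^2(\lambda_1-\lambda_3)^2(\lambda_2-\lambda_3)^2},$$ i.e. the j-invariant of the elliptic curve $y^2=\det(xC+D)$. Finally $S=S_0\cup S_{1728}$ with $S_0=\pi(\mathfrak{C})\cap\overline{j}^{-1}(0)$ and $S_{1728}=\pi(\mathfrak{C})\cap\overline{j}^{-1}(1728)$. *)

(* Defs.v *)
From HB Require Import structures.
From mathcomp Require Import all_boot all_order all_algebra all_fingroup.
From mathcomp Require Import generic_quotient.
From mathcomp Require Import all_classical all_reals all_analysis.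
From mathcomp Require Export complex.

Set Implicit Arguments.
Unset Strict Implicit.
Unset Printing Implicit Defensive.

Import Order.TTheory GRing.Theory Num.Theory.
Import numFieldNormedType.Exports.

Local Open Scope classical_set_scope.
Local Open Scope ring_scope.
Local Open Scope quotient_scope.
Local Open Scope card_scope.

(** Everything is defined over a [numClosedFieldType] [C] carrying its norm
    topology; the field of complex numbers is the instance [R[i]] for
    [R : realType]. *)

Section Spaces.
Variable C : numClosedFieldType.

(** A space with a distinguished presheaf of [C]-valued functions.  Only open sets
    [W] are relevant in [hol W f], read "[f] is holomorphic on [W]". *)
Record holSpace := HolSpace {
  hs_space :> topologicalType;
  hol : set hs_space -> (hs_space -> C) -> Prop }.

Definition affine_space (V : normedModType C) : holSpace :=
  @HolSpace V (fun W f => forall x, W x -> differentiable (f : V -> C^o) x).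

(** The structure induced on [X] by a map [i] into a space [Y]: holomorphic
    functions are those that locally extend to [Y].  For an inclusion this is the
    structure of a subspace; for a bijection it is transport of structure. *)
Definition induced_space (X : choiceType) (Y : holSpace) (i : X -> Y) :
    holSpace :=
  @HolSpace (initial_topology i) (fun W f =>
    forall x, W x -> exists (W' : set Y) (g : Y -> C),
      [/\ open W', W' (i x), hol W' g &
          forall y, W y -> W' (i y) -> f y = g (i y)]).

Definition quotient_space (T : holSpace) (Q : quotType T) : holSpace :=
  @HolSpace (quotient_topology Q) (fun W f =>
    hol (\pi_Q @^-1` W : set T) (f \o \pi_Q)).

Definition holomorphic_on (X Y : holSpace) (W : set X) (f : X -> Y) : Prop :=
  (forall V : set Y, open V -> open (W `&` f @^-1` V)) /\
  (forall (V : set Y) (g : Y -> C), open V -> hol V g ->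
     hol (W `&` f @^-1` V) (g \o f)).

Definition biholomorphic (X Y : holSpace) (W : set X) (V : set Y) (f : X -> Y) :
    Prop :=
  exists g : Y -> X,
    [/\ set_fun W V f, set_fun V W g,
        {in W, cancel f g} /\ {in V, cancel g f},
        holomorphic_on W f & holomorphic_on V g].

(** [f] is a holomorphic covering, with [d] sheets, of the open set [B] of [Y]. *)
Definition holomorphic_covering (X Y : holSpace) (B : set Y) (f : X -> Y)
    (d : nat) : Prop :=
  [/\ open B, forall x, B (f x), holomorphic_on setT f &
      forall y, B y -> exists (V : set Y) (W : 'I_d -> set X),
        [/\ open V, V y /\ V `<=` B,
            (forall k, open (W k)) /\ trivIset setT W,
            f @^-1` V = \bigcup_k W k &
            forall k, biholomorphic (W k) V f]].

End Spaces.

Section Projectivization.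
Variables (C : numClosedFieldType) (V : normedModType C) (S : set V).

Definition nonzero_vec := set_type [set v : V | S v /\ v != 0].

Definition proportional (u v : nonzero_vec) : bool :=
  `[< exists2 c : C, c != 0 & val v = c *: val u >].

Lemma proportional_refl : reflexive proportional.
Proof. by move=> u; apply/asboolP; exists 1; rewrite ?oner_neq0 ?scale1r. Qed.

Lemma proportional_sym : symmetric proportional.
Proof.
suff H u v : proportional u v -> proportional v u by move=> u v; apply/idP/idP; apply: H.
move=> /asboolP[c c0 e]; apply/asboolP; exists c^-1; first by rewrite invr_eq0.
by rewrite e scalerA mulVf // scale1r.
Qed.

Lemma proportional_trans : transitive proportional.
Proof.
move=> v u w /asboolP[c c0 e] /asboolP[d d0 e']; apply/asboolP.
by exists (d * c); rewrite ?mulf_neq0 // e' e scalerA.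
Qed.

Canonical proportional_equiv :=
  EquivRel proportional proportional_refl proportional_sym proportional_trans.

(** The projectivization of the linear subspace [S] of [V]. *)
Definition proj := {eq_quot proportional_equiv}.

End Projectivization.

Section Plane.
Variable C : numClosedFieldType.

Definition CP2 := proj [set: 'rV[C]_3].

Definition coords (p : CP2) : 'rV[C]_3 := val (repr p).

Definition CP2_space : holSpace C :=
  @quotient_space C
    (@induced_space C (nonzero_vec [set: 'rV[C]_3])
      (affine_space 'rV[C]_3) val) CP2.

Definition permuted (p q : CP2) : bool :=
  `[< exists (s : 'S_3) (c : C),
        c != 0 /\ coords q = c *: col_perm s (coords p) >].

Lemma permuted_refl : reflexive permuted.
Proof.
move=> p; apply/asboolP; exists 1%g, 1; split; first exact: oner_neq0.
by rewrite col_perm1 scale1r.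
Qed.

Lemma permuted_sym : symmetric permuted.
Proof.
suff H u v : permuted u v -> permuted v u by move=> u v; apply/idP/idP; apply: H.
move=> /asboolP[s [c [c0 e]]]; apply/asboolP; exists s^-1%g, c^-1.
rewrite invr_eq0; split=> //; rewrite e.
by apply/rowP => i; rewrite !mxE permKV mulrA mulVf // mul1r.
Qed.

Lemma permuted_trans : transitive permuted.
Proof.
move=> v u w /asboolP[s [c [c0 e]]] /asboolP[s' [d [d0 e']]]; apply/asboolP.
exists (s' * s)%g, (d * c); rewrite mulf_neq0 //; split=> //; rewrite e' e.
by apply/rowP => i; rewrite !mxE permM mulrA.
Qed.

Canonical permuted_equiv :=
  EquivRel permuted permuted_refl permuted_sym permuted_trans.

Definition CP2_S3 := {eq_quot permuted_equiv}.

Definition CP2_S3_space : holSpace C := @quotient_space C CP2_space CP2_S3.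

End Plane.

Section Conics.
Variable C : numClosedFieldType.

Definition conic := proj [set A : 'M[C]_3 | A^T = A].

Definition conic_mx (c : conic) : 'M[C]_3 := val (repr c).

Definition on_conic (c : conic) (p : CP2 C) : Prop :=
  coords p *m conic_mx c *m (coords p)^T = 0.

Definition transverse_pair : set (conic * conic) :=
  [set cd | [/\ \det (conic_mx cd.1) != 0, \det (conic_mx cd.2) != 0 &
     [set p | on_conic cd.1 p /\ on_conic cd.2 p] #= `I_4]].

(** The set $\mathfrak O$ of pairs of non-degenerate conics meeting in four
    points. *)
Definition OO := set_type transverse_pair.

(** The conic [d] is the image of [c] under congruence by [A]. *)
Definition congruent_by (A : 'M[C]_3) (c d : conic) : Prop :=
  exists2 k : C, k != 0 & conic_mx d = k *: (A^T *m conic_mx c *m A).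

(** Orbits of $PGL_3$ and of $GL_3$ coincide, as scalar matrices act
    trivially on conics. *)
Definition same_orbit (x y : OO) : bool :=
  `[< exists A : 'M[C]_3, [/\ A \in unitmx,
        congruent_by A (val x).1 (val y).1 &
        congruent_by A (val x).2 (val y).2] >].

Lemma congruent_by1 c : congruent_by 1%:M c c.
Proof.
by exists 1; rewrite ?oner_neq0 // trmx1 mul1mx mulmx1 scale1r.
Qed.

Lemma congruent_byV A c d : A \in unitmx ->
  congruent_by A c d -> congruent_by (invmx A) d c.
Proof.
move=> uA [k k0 e]; exists k^-1; first by rewrite invr_eq0.
rewrite e -scalemxAr -scalemxAl scalerA mulVf // scale1r trmx_inv.
by rewrite !mulmxA mulVmx ?unitmx_tr // mul1mx -mulmxA mulmxV // mulmx1.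
Qed.

Lemma congruent_byM A B c d e :
  congruent_by A c d -> congruent_by B d e -> congruent_by (A *m B) c e.
Proof.
move=> [k k0 h] [l l0 h']; exists (l * k); first by rewrite mulf_neq0.
by rewrite h' h -scalemxAr -scalemxAl scalerA trmx_mul !mulmxA.
Qed.

Lemma same_orbit_refl : reflexive same_orbit.
Proof.
move=> x; apply/asboolP; exists 1%:M.
by split; [exact: unitmx1 | exact: congruent_by1 | exact: congruent_by1].
Qed.

Lemma same_orbit_sym : symmetric same_orbit.
Proof.
suff H u v : same_orbit u v -> same_orbit v u by move=> u v; apply/idP/idP; apply: H.
move=> /asboolP[A [uA h1 h2]]; apply/asboolP; exists (invmx A).
by split; [rewrite unitmx_inv | exact: congruent_byV | exact: congruent_byV].
Qed.

Lemma same_orbit_trans : transitive same_orbit.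
Proof.
move=> v u w /asboolP[A [uA h1 h2]] /asboolP[B [uB h3 h4]]; apply/asboolP.
exists (A *m B); rewrite unitmx_mul uA uB.
by split=> //; [exact: congruent_byM h1 h3 | exact: congruent_byM h2 h4].
Qed.

Canonical same_orbit_equiv :=
  EquivRel same_orbit same_orbit_refl same_orbit_sym same_orbit_trans.

(** The moduli space $\mathcal M$ of pairs of conics. *)
Definition MM := {eq_quot same_orbit_equiv}.

(** The polynomial $\det(tA + B)$ in the variable $t$. *)
Definition det_pencil (A B : 'M[C]_3) : {poly C} :=
  \det ('X *: map_mx polyC A + map_mx polyC B).

Definition poly_roots (p : {poly C}) : seq C := sval (closed_field_poly_normal p).

Definition pt100 : nonzero_vec [set: 'rV[C]_3].
Proof.
exists (delta_mx 0 0); apply/mem_set; split=> //.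
by apply/eqP => /rowP/(_ 0)/eqP; rewrite !mxE !eqxx /= oner_eq0.
Defined.

(** The point [[l1 : l2 : l3]] of the roots, in any order, of
    $\det(tC + D)$.  On [OO] the roots are three non-zero numbers, so that the
    default value [pt100] of [insubd] is never taken. *)
Definition root_point (x : OO) : CP2_S3 C :=
  let r := poly_roots (det_pencil (conic_mx (val x).1) (conic_mx (val x).2)) in
  \pi_(CP2_S3 C) (\pi_(CP2 C) (insubd pt100 (\row_(i < 3) r`_i))).

(** The class of [root_point] only depends on the orbit: this is the
    identification of [MM] with an open subset of $\mathbb{CP}^2/S_3$. *)
Definition moduli (m : MM) : CP2_S3 C := root_point (repr m).

Definition MM_space : holSpace C :=
  @induced_space C MM (CP2_S3_space C) moduli.

(** [s] is a holomorphic branch of $\sqrt{\det(tC + D)}$ near $0$, whose Taylor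
    coefficient $A_2$ of $t^2$ at $0$ is [s''(0) / 2!].  Changing the branch or the matrices
    representing the conics multiplies $A_2$ by a non-zero constant. *)
Definition cayley : set OO :=
  [set x | exists s : C -> C^o,
     [/\ \forall t \near (0 : C), derivable s t 1,
         \forall t \near (0 : C),
           s t ^+ 2 = \det (t *: conic_mx (val x).1 + conic_mx (val x).2) &
         s^`(2)%classic 0 / (2`!)%:R = 0]].

Definition pi_cayley : set MM := \pi_MM @` cayley.

Definition jfun (l : 'rV[C]_3) : C :=
  let l1 := l 0 0 in let l2 := l 0 1 in let l3 := l 0 2%:R in
  256 * (l1 ^+ 2 - l1 * l2 - l1 * l3 + l2 ^+ 2 - l2 * l3 + l3 ^+ 2) ^+ 3
  / ((l1 - l2) ^+ 2 * (l1 - l3) ^+ 2 * (l2 - l3) ^+ 2).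

Definition jbar (m : MM) : C := jfun (coords (repr (moduli m))).

Definition S_ (a : C) : set MM := pi_cayley `&` jbar @^-1` [set a].

Definition SS : set MM := S_ 0 `|` S_ 1728.

(** The curve $\pi(\mathfrak C) \setminus S$ with the structure induced by [MM]. *)
Definition cayley_curve : holSpace C :=
  @induced_space C (set_type (pi_cayley `\` SS)) MM_space set_val.

Definition jbar_restr (m : cayley_curve) : affine_space C^o := jbar (set_val m).

End Conics.

(* Main.v *)
Require Import Defs.
From mathcomp Require Import all_boot all_order all_algebra all_fingroup.
From mathcomp Require Import generic_quotient separable.
From mathcomp Require Import all_classical all_reals all_analysis.
From mathcomp Require Import ring.

(** For a pair in $\mathfrak O$ the four common points of the two conics are in
    general position; in the projective frame they define, both conics become
    symmetric matrices with zero diagonal and the pair is determined, up to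
    congruence, by the roots of $\det(tC + D)$.  Hence $\mathcal M$ is the set of
    classes of triples of distinct non-zero numbers.  In terms of the elementary
    symmetric functions of the roots, the Cayley curve is $e_2^2 = 4 e_1 e_3$, and
    $e_1 = 0$ on it forces $\overline j = 0$.  So, away from $S$, the quotient
    $s = e_2 / e_1^2$ is a global coordinate, in which
    $$\overline j = \frac{4096 (1 - 3 s)^3}{s^3 (8 - 27 s)}, \qquad
      \overline j - 1728 = \frac{64 (27 s^2 - 36 s + 8)^2}{s^3 (8 - 27 s)}.$$
    For $y \neq 0, 1728$ the equation $\overline j = y$ is a quartic in $s$ without
    double roots, and its four roots are locally holomorphic functions of $y$.
    Conversely the point of parameter $s$ is represented by the roots of
    $X^3 - X^2 + s X - s^2 / 4$, which are locally holomorphic in $s$. *)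

Set Implicit Arguments.
Unset Strict Implicit.
Unset Printing Implicit Defensive.

Import Order.TTheory GRing.Theory Num.Theory.
Import numFieldNormedType.Exports.

Local Open Scope classical_set_scope.
Local Open Scope ring_scope.
Local Open Scope quotient_scope.
Local Open Scope card_scope.
Local Open Scope complex_scope.

(** * Holomorphic dependence of roots on coefficients *)

(** In the coordinate $s$ the function $\overline j$ is a rational map of degree 4 branched over
    three values only. Over 0 lie the triple point $s = 1/3$ and the simple point $s = \infty$,
    where $e_1 = 0$; over 1728 lie the two double zeros of $27 s^2 - 36 s + 8$; over $\infty$ lie
    the triple point $s = 0$ and the simple point $s = 8/27$, where roots collide. Ramification 2 +
    2 + 2 is all that a map of degree 4 between spheres admits, so there is no further critical
    value. The field is any algebraically closed numeric field, possibly not complete, so neither an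
    implicit function theorem nor Cauchy's formula is at hand: the differentiability of roots, and
    the second derivative of a square root, come from polynomial identities. The other obstacle is
    that $\mathcal M$ is reached through nested quotients and induced structures. Questions of
    openness and holomorphy are moved to vectors of roots, and local lifts fit together because $s$
    is injective on the curve. *)

Section RootContinuity.
Variable C : numClosedFieldType.

(** The order of [C] is only partial; a minimum exists because positive elements are real, hence
    comparable. *)
Lemma seq_pos_lb (s : seq C) : all (fun a => 0 < a) s ->
  exists2 e : C, 0 < e & all (fun a => e <= a) s.
Proof.
elim: s => [_|a s IH /= /andP[a0 /IH[e e0 es]]]; first by exists 1.
case: (real_leP (gtr0_real a0) (gtr0_real e0)) => ae.
  by exists a => //=; rewrite lexx /=; apply: sub_all es => x; apply: le_trans.
by exists e => //=; rewrite (ltW ae).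
Qed.

Lemma separating_radius n (r : 'I_n -> C) : injective r ->
  exists2 e : C, 0 < e & forall i j x, `|x - r i| < e -> `|x - r j| < e -> i = j.
Proof.
move=> ri.
(* Diagonal pairs contribute a dummy 1, the others half a distance, so that balls of radius [e] are
   disjoint by the triangle inequality. *)
pose s := [seq (if p.1 == p.2 then 1 else `|r p.1 - r p.2| / 2) | p : 'I_n * 'I_n].
have /seq_pos_lb[e e0 /allP es] : all (fun a => 0 < a) s.
  apply/allP => _ /mapP[[i j] _ ->] /=; case: eqVneq => // ij.
  by rewrite divr_gt0 // normr_gt0 subr_eq0 (inj_eq ri).
exists e => // i j x xi xj; apply/eqP/negP => /negP ij.
have : e <= `|r i - r j| / 2.
  apply: es; apply/mapP; exists (i, j); rewrite ?mem_enum //=.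
  by rewrite (negbTE ij).
rewrite ler_pdivlMr // => le1; suff: e * 2 < e * 2 by rewrite ltxx.
apply: le_lt_trans le1 _; rewrite mulr_natr.
rewrite (_ : r i - r j = (x - r j) - (x - r i)); last by ring.
by rewrite mulr2n (le_lt_trans (ler_normB _ _)) // ltrD.
Qed.

(* The value of [P y] at [x] is the product of the distances of [x] to the
   roots, so one of these is small when the value is. *)
Lemma root_near n (P : C -> {poly C}) (y0 x0 e : C) :
  (forall y, P y \is monic) -> (forall y, size (P y) = n.+1) ->
  (forall k, {for y0, continuous (fun y => (P y)`_k)}) ->
  root (P y0) x0 -> 0 < e ->
  \forall y \near y0, exists2 x, root (P y) x & `|x - x0| < e.
Proof.
move=> Pm Ps Pc x0r e0.
have Pxc : {for y0, continuous (fun y => (P y).[x0])}.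
  rewrite (_ : (fun y => _) = (fun y => \sum_(i < n.+1) (P y)`_i * x0 ^+ i)).
    apply: (@cvg_big _ _ _ _ _ _ _ (nbhs y0)) => [|i _]; first exact: add_continuous.
    by apply: (@cvgM _ _ (nbhs y0)); [exact: Pc|exact: cvg_cst].
  by apply/funext => y; rewrite horner_coef Ps.
have Pn : \forall y \near y0, `|(P y).[x0] - (P y0).[x0]| < e ^+ n.
  exact: cvgr_distC_lt _ _ Pxc _ (exprn_gt0 n e0).
apply: filterS Pn => y; rewrite (rootP x0r) subr0.
have [rs] := closed_field_poly_normal (P y); rewrite (monicP (Pm y)) scale1r => Prs.
have srs : size rs = n.
  by have := Ps y; rewrite Prs size_prod_XsubC => -[].
move=> Pe; have /hasP[x xrs xe] : has (fun x => `|x - x0| < e) rs.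
  apply: contraLR Pe => /hasPn rse.
  rewrite Prs horner_prod normr_prod -real_leNgt ?ger0_real ?prodr_ge0 ?exprn_ge0 //.
  - rewrite -srs; elim: (rs) rse {Prs srs} => [_|x s IH rse].
      by rewrite big_nil.
    rewrite big_cons /= exprS ler_pM ?(ltW e0) ?exprn_ge0 ?(ltW e0) //.
      rewrite hornerXsubC distrC real_leNgt ?ger0_real ?(ltW e0) //.
      by rewrite rse // mem_head.
    by apply: IH => z zs; rewrite rse // in_cons zs orbT.
  - by rewrite ltW.
exists x => //; by rewrite Prs root_prod_XsubC.
Qed.

(** As [a] vanishes at [y], the difference quotient of the product is that of [a] times a value of
    [b], so continuity of [b] is enough. The intended [b] contains a root of which only continuity
    is known so far. *)
Lemma derivable_mul_vanishing (a b : C -> C^o) (y : C) :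
  derivable a y 1 -> a y = 0 -> {for y, continuous b} ->
  derivable (fun z => a z * b z) y 1.
Proof.
move=> /cvg_ex[l al] ay bc; apply/cvg_ex; exists (l * b y).
rewrite (_ : (fun h : C => _) = (fun h : C =>
    (h^-1 *: ((a \o shift y) (h *: 1) - a y)) * (b \o shift y) (h *: 1))); last first.
  by apply/funext => h /=; rewrite ay mul0r !subr0 scalerAl.
apply: (@cvgM _ _ 0^') => //.
apply: (@cvg_comp _ _ _ (fun h : C => h *: 1 + y) b _ (nbhs y)) => //.
have : (h + y) @[h --> (0 : C)] --> 0 + y.
  by apply: (@cvgD _ _ _ (nbhs 0)); [exact: cvg_id|exact: cvg_cst].
rewrite add0r (_ : (fun h : C => h *: 1 + y) = (fun h : C => h + y)); last first.
  by apply/funext => h; rewrite /GRing.scale/= mulr1.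
by apply: cvg_trans; apply: cvg_app; exact: cvg_within.
Qed.

(* [s i y] is the root of [P y] in a ball around [r i]; there is only one, as
   the balls are disjoint and [P y] has [n] roots. *)
Lemma differentiable_roots n (P : C -> {poly C}) (y0 : C) (r : 'I_n -> C) :
  (forall y, P y \is monic) -> (forall y, size (P y) = n.+1) ->
  (\forall y \near y0, forall k, differentiable (fun y => (P y)`_k : C^o) y) ->
  injective r -> (forall i, root (P y0) (r i)) ->
  exists2 s : 'I_n -> C -> C^o, forall i, s i y0 = r i &
    exists2 e : C, (forall i j x, `|x - r i| < e -> `|x - r j| < e -> i = j) &
    \forall y \near y0, [/\ P y = \prod_(i < n) ('X - (s i y)%:P),
      forall i, `|s i y - r i| < e & forall i, differentiable (s i) y].
Proof.
move=> Pm Ps Pd r_inj r_root; have [e e0 re] := separating_radius r_inj.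
(* The value at [y0] is prescribed, so that [s i y0 = r i] is immediate; elsewhere [xget] falls back
   on [r i] when no root lies in the ball. *)
pose s i y := if y == y0 then r i
  else xget (r i) [set x | root (P y) x /\ `|x - r i| < e].
exists s => [i|]; first by rewrite /s eqxx.
exists e => //.
have Pc y : (forall k, differentiable (fun y => (P y)`_k : C^o) y) ->
    forall k, {for y, continuous (fun y => (P y)`_k)}.
  by move=> + k => /(_ k) /differentiable_continuous.
have near_s : \forall y \near y0, forall i, root (P y) (s i y) /\ `|s i y - r i| < e.
  have near_r : \forall y \near y0, forall i, exists2 x, root (P y) x & `|x - r i| < e.
    apply: (@filter_forall _ _ _ (nbhs y0)) => i.
    by apply: root_near; rewrite ?(nbhs_singleton Pd) //;
      apply: Pc; exact: nbhs_singleton Pd.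
  apply: filterS near_r => y + i => /(_ i)[x xr xe].
  rewrite /s; case: eqVneq => [->|_]; first by rewrite subrr normr0.
  by case: xgetP => [z -> //|/(_ x)/=]; tauto.
have sP y : (forall i, root (P y) (s i y) /\ `|s i y - r i| < e) ->
    P y = \prod_(i < n) ('X - (s i y)%:P) /\ injective (s^~ y).
  move=> sy; have s_inj : injective (s^~ y).
    by move=> i j ij; apply: (re i j (s i y)); [case: (sy i)|rewrite ij; case: (sy j)].
  split=> //; rewrite [LHS](@all_roots_prod_XsubC _ _ [seq s i y | i <- enum 'I_n]).
  - by rewrite (monicP (Pm y)) scale1r big_map big_enum.
  - by rewrite size_map size_enum_ord Ps.
  - by apply/allP => _ /mapP[i _ ->]; case: (sy i).
  - by rewrite uniq_rootsE map_inj_uniq ?enum_uniq.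
have near_G : \forall y \near y0, (forall i, root (P y) (s i y) /\ `|s i y - r i| < e)
    /\ forall k, differentiable (fun y => (P y)`_k : C^o) y.
  by apply: filterI.
(* Differentiability is wanted on a whole neighbourhood, hence at every [y1] of the interior and not
   only at [y0]. *)
apply: filterS (nbhs_interior near_G) => y1 yG.
have [sy1 dy1] := nbhs_singleton yG; have [Py1 s_inj] := sP _ sy1.
split=> [||i]; [exact: Py1|by move=> i; case: (sy1 i)|].
have s_cont : {for y1, continuous (s i)}.
  apply/(@cvgrPdistC_lt _ _ _ (nbhs y1)) => eps eps0; have [ri ei] := sy1 i.
  (* The bound [eps] gives continuity; the second bound keeps the root found near [s i y1] inside
     the ball of [r i], which identifies it as [s i y]. *)
  have /seq_pos_lb[d d0 /and3P[d1 d2 _]] : all (fun a => 0 < a) [:: eps; e - `|s i y1 - r i|].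
    by rewrite /= eps0 subr_gt0 ei.
  have near_x := root_near Pm Ps (Pc _ dy1) ri d0.
  apply: filterS (filterI near_x yG) => y [[x xr xd] [sy _]].
  have [Py _] := sP _ sy.
  have /mapP[j _ xj] : x \in [seq s i y | i <- enum 'I_n].
    by rewrite -root_prod_XsubC big_map big_enum -Py.
  suff ij : i = j by rewrite ij -xj -ij (lt_le_trans xd).
  apply: (re _ _ x); last by rewrite xj; case: (sy j).
  rewrite (_ : x - r i = (x - s i y1) + (s i y1 - r i)); last by ring.
  rewrite (le_lt_trans (ler_normD _ _)) // -ltrBrDr.
  exact: lt_le_trans xd d2.
pose Q x := \prod_(j < n | j != i) (x - s j y1).
have Qc : {for y1, continuous (fun y => Q (s i y))}.
  apply: (@cvg_big _ _ _ _ _ _ _ (nbhs y1)) => [|j _]; first exact: mul_continuous.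
  by apply: (@cvgB _ _ _ (nbhs y1)); [exact: s_cont|exact: cvg_cst].
have Q0 : Q (s i y1) != 0.
  by apply/prodf_neq0 => j ji; rewrite subr_eq0 (inj_eq s_inj) eq_sym.
apply/derivable1_diffP.
(* Since [s i y] is a root of [P y], the value of [P y - P y1] there is
   [- (s i y - s i y1) * Q (s i y)]. Dividing by [Q] expresses the increment of the root by the
   increments of the coefficients, which vanish at [y1], times continuous factors. *)
have near_s1 : \forall y \near y1, - \sum_(k < n.+1)
    ((P y)`_k - (P y1)`_k) * (s i y ^+ k / Q (s i y)) + s i y1 = s i y.
  have Qn : \forall y \near y1, Q (s i y) != 0.
    have := @cvgr_neq0 _ _ _ (nbhs y1) _ (fun y => Q (s i y)) _ Qc Q0.
    exact.
  apply: filterS (filterI Qn yG) => y [Qy [sy _]].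
  have [Py _] := sP _ sy.
  have E : (P y).[s i y] - (P y1).[s i y] = - ((s i y - s i y1) * Q (s i y)).
    rewrite (rootP (sy i).1) sub0r Py1 horner_prod (bigD1 i) //= hornerXsubC.
    by congr (- (_ * _)); apply: eq_bigr => j _; rewrite hornerXsubC.
  under eq_bigr do rewrite mulrA; rewrite -mulr_suml.
  suff -> : \sum_(k < n.+1) ((P y)`_k - (P y1)`_k) * s i y ^+ k
    = - ((s i y - s i y1) * Q (s i y)) by rewrite mulNr opprK mulfK // subrK.
  rewrite -E !horner_coef !Ps -sumrB; apply: eq_bigr => k _.
  by rewrite mulrBl.
apply: (near_eq_derivable near_s1).
apply: derivableD; last exact: derivable_cst.
apply: derivableN.
rewrite (_ : (fun y => _) = \sum_(k < n.+1)
  (fun y => ((P y)`_k - (P y1)`_k) * (s i y ^+ k / Q (s i y))) :> (C -> C^o)); last first.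
  by apply/funext => y; rewrite fct_sumE.
apply: derivable_sum => k; apply: derivable_mul_vanishing.
- apply/derivableB; last exact: derivable_cst.
  exact/derivable1_diffP/dy1.
- by rewrite subrr.
- apply: (@cvgM _ _ (nbhs y1)).
    elim: (k : nat) => [|m IH]; first by apply: (@cvg_cst _ _ _ (nbhs y1)).
    rewrite (_ : (fun y => _) = (fun y => s i y * s i y ^+ m)).
      by rewrite exprS; apply: (@cvgM _ _ (nbhs y1)).
    by apply/funext => y; rewrite exprS.
  by apply: (@cvgV _ _ (nbhs y1)).
Qed.

End RootContinuity.

(** * Normal form of a pair of conics *)

Section Matrices3.
Variable C : numClosedFieldType.

Definition row3 (a b c : C) : 'rV[C]_3 := \row_(i < 3) [:: a; b; c]`_i.

Lemma ord3E (i : 'I_3) : [\/ i = 0, i = 1 | i = 2%:R].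
Proof.
by case: i => [[|[|[|//]]] h]; [apply: Or31|apply: Or32|apply: Or33]; apply/val_inj.
Qed.

Lemma row3P (u v : 'rV[C]_3) :
  u 0 0 = v 0 0 -> u 0 1 = v 0 1 -> u 0 2%:R = v 0 2%:R -> u = v.
Proof. by move=> u0 u1 u2; apply/rowP => i; case: (ord3E i) => ->. Qed.

Lemma sum_ord3 (V : zmodType) (F : 'I_3 -> V) : \sum_i F i = F 0 + F 1 + F 2%:R.
Proof.
rewrite !big_ord_recr big_ord0 /= add0r.
by congr (F _ + F _ + F _); apply/val_inj.
Qed.

Lemma det3 (A : 'M[C]_3) : \det A =
  A 0 0 * (A 1 1 * A 2%:R 2%:R - A 1 2%:R * A 2%:R 1)
  - A 0 1 * (A 1 0 * A 2%:R 2%:R - A 1 2%:R * A 2%:R 0)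
  + A 0 2%:R * (A 1 0 * A 2%:R 1 - A 1 1 * A 2%:R 0).
Proof.
(* Entries become values of a function of natural numbers, so that the lifted indices of the nested
   expansions reduce by computation. *)
have -> : A = \matrix_(i, j) A (inord i) (inord j).
  by apply/matrixP => i j; rewrite mxE !inord_val.
move: (fun i j : nat => A (inord i) (inord j)) => f.
rewrite (expand_det_row _ 0) sum_ord3 /cofactor.
rewrite !(expand_det_row _ 0) !big_ord_recl !big_ord0 /cofactor !det_mx11 !mxE /=.
rewrite /bump /= ?expr0 ?expr1 ?addn0 ?add0n ?expr1 ?mul1r ?exprD ?expr1 ?expr0.
by ring.
Qed.

(** These forms are the conics through the three coordinate points; [a], [b], [c] are the entries at
    (0,1), (1,2), (0,2), in this order. *)
Definition zdiag (a b c : C) : 'M[C]_3 :=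
  \matrix_(i < 3, j < 3) nth 0 (nth [::] [:: [:: 0; a; c]; [:: a; 0; b]; [:: c; b; 0]] i) j.

Lemma zdiagP (A : 'M[C]_3) : A^T = A -> (forall i, A i i = 0) ->
  A = zdiag (A 0 1) (A 1 2%:R) (A 0 2%:R).
Proof.
move=> At A0; have As i j : A i j = A j i by rewrite -{1}At mxE.
by apply/matrixP => i j; case: (ord3E i) => ->; case: (ord3E j) => ->; rewrite mxE //= As.
Qed.

Lemma det_zdiag a b c : \det (zdiag a b c) = 2 * (a * b * c).
Proof. by rewrite det3 !mxE /=; ring. Qed.

Lemma quad_zdiag (v : 'rV[C]_3) a b c : (v *m zdiag a b c *m v^T) 0 0 =
  2 * (a * (v 0 0 * v 0 1) + b * (v 0 1 * v 0 2%:R) + c * (v 0 0 * v 0 2%:R)).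
Proof. rewrite mxE sum_ord3 !mxE !sum_ord3 !mxE /=; ring. Qed.

Lemma mx11_eq0 (A : 'M[C]_1) : (A == 0) = (A 0 0 == 0).
Proof.
apply/eqP/eqP => [->|A0]; first by rewrite mxE.
by apply/matrixP => i j; rewrite !ord1 A0 mxE.
Qed.

(* Otherwise [u] and [v] span an isotropic plane, too big for a nondegenerate
   form in dimension 3. *)
Lemma isotropic_nonorthogonal (A : 'M[C]_3) (u v : 'rV[C]_3) :
  \det A != 0 -> A^T = A -> u *m A *m u^T = 0 -> v *m A *m v^T = 0 ->
  v != 0 -> (forall c, u != c *: v) -> u *m A *m v^T != 0.
Proof.
move=> dA At uu vv v0 uv; apply/eqP => uAv.
have vAu : v *m A *m u^T = 0.
  by apply: trmx_inj; rewrite trmx0 !trmx_mul trmxK At mulmxA.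
pose U : 'M[C]_(1 + 1, 3) := col_mx u v.
have U0 : (U *m A) *m U^T = 0.
  rewrite /U mul_col_mx tr_col_mx mul_col_mx !mul_mx_row uu vv uAv vAu.
  by rewrite !row_mx0 col_mx0.
have /eqP Ur : row_free U.
  apply: inj_row_free => w; rewrite -[w]hsubmxK mul_row_col.
  rewrite [lsubmx w]mx11_scalar [rsubmx w]mx11_scalar !mul_scalar_mx.
  set c := lsubmx w 0 0; set d := rsubmx w 0 0 => cd.
  have c0 : c = 0.
    apply/eqP/negP => /negP c0; have := uv (- (c^-1 * d)).
    rewrite -subr_eq0 scaleNr opprK.
    have -> : u + (c^-1 * d) *: v = c^-1 *: (c *: u + d *: v).
      by rewrite scalerDr !scalerA mulVf // scale1r.
    by rewrite cd scaler0 eqxx.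
  move: cd; rewrite c0 scale0r add0r => /eqP; rewrite scaler_eq0 (negbTE v0) orbF.
  by move=> /eqP ->; rewrite !(raddf0 (@scalar_mx _ 1)) row_mx0.
have := mulmx0_rank_max U0.
by rewrite mxrank_tr mxrankMfree ?Ur // row_free_unit unitmxE unitfE.
Qed.

Lemma isotropic_row3 a b c (v : 'rV[C]_3) :
  v *m zdiag a b c *m v^T = 0 <->
  a * (v 0 0 * v 0 1) + b * (v 0 1 * v 0 2%:R) + c * (v 0 0 * v 0 2%:R) = 0.
Proof.
split=> [/matrixP/(_ 0 0)|h].
  by rewrite quad_zdiag mxE => /eqP; rewrite mulf_eq0 pnatr_eq0 /= => /eqP.
by apply/eqP; rewrite mx11_eq0 quad_zdiag h mulr0.
Qed.

(* Four isotropic points are in general position; scaling the first three so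
   that their sum is the fourth, they become the standard frame. *)
Lemma isotropic_frame (A : 'M[C]_3) (u : nat -> 'rV[C]_3) :
  \det A != 0 -> A^T = A ->
  (forall i, (i < 4)%N -> u i != 0) ->
  (forall i j c, (i < 4)%N -> (j < 4)%N -> i != j -> u i != c *: u j) ->
  (forall i, (i < 4)%N -> u i *m A *m (u i)^T = 0) ->
  exists2 P : 'M[C]_3, P \in unitmx & exists w : 'rV[C]_3,
    [/\ forall i, w 0 i != 0, forall i : 'I_3, w 0 i *: u i = row i P &
        u 3 = row3 1 1 1 *m P].
Proof.
move=> dA At u0 uI uA.
pose P0 : 'M[C]_3 := \matrix_(i < 3) u i.
have rP0 (i : 'I_3) : row i P0 = u i by rewrite rowK.
have P0E (B : 'M[C]_3) (i j : 'I_3) : (P0 *m B *m P0^T) i j = (u i *m B *m (u j)^T) 0 0.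
  by rewrite -!rP0 -row_mul tr_row mxE [RHS]mxE; apply: eq_bigr => k _; rewrite !mxE.
have NA : P0 *m A *m P0^T = zdiag ((u 0%N *m A *m (u 1%N)^T) 0 0)
    ((u 1%N *m A *m (u 2)^T) 0 0) ((u 0%N *m A *m (u 2)^T) 0 0).
  rewrite [LHS]zdiagP ?P0E //; first by rewrite !trmx_mul trmxK At mulmxA.
  by move=> i; rewrite P0E uA ?mxE //; case: i => i /= /ltnW.
have ne i j : (i < 4)%N -> (j < 4)%N -> i != j -> (u i *m A *m (u j)^T) 0 0 != 0.
  move=> i4 j4 ij; rewrite -mx11_eq0.
  by apply: isotropic_nonorthogonal; auto.
(* No off-diagonal entry of the Gram matrix vanishes, so [det_zdiag] yields the independence of the
   first three points. *)
have uP0 : P0 \in unitmx.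
  rewrite unitmxE unitfE; apply/negP => /eqP dP0.
  have /eqP := congr1 determinant NA; rewrite det_zdiag !det_mulmx dP0 !mul0r eq_sym.
  by rewrite !mulf_eq0 pnatr_eq0 /= -?orbA !(negbTE (ne _ _ _ _ _)).
have [w u3E] : exists w, u 3 = w *m P0 by exists (u 3 *m invmx P0); rewrite mulmxKV.
have wE : u 3 = w 0 0 *: u 0%N + w 0 1 *: u 1%N + w 0 2%:R *: u 2.
  by rewrite {1}u3E mulmx_sum_row sum_ord3 !rP0.
have wN : w *m (P0 *m A *m P0^T) *m w^T = 0.
  by rewrite !mulmxA -u3E -mulmxA -trmx_mul -u3E uA.
move: wN; rewrite NA => /isotropic_row3 wA.
have wn0 (i : 'I_3) : w 0 i != 0.
  have s01 := ne 0 1 isT isT isT; have s12 := ne 1 2 isT isT isT.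
  have s02 := ne 0 2 isT isT isT.
  have u3i j c : (j < 3)%N -> u 3 <> c *: u j.
    by move=> j3; apply/eqP; apply: uI => //; rewrite ?ltnS ?(ltnW j3) // gtn_eqF.
  (* If one coordinate of the fourth point were 0, its isotropy would kill a second one, and the
     point would coincide with one of the first three. *)
  apply/negP => /eqP wi0; case: (ord3E i) wi0 => -> wi0; move: wA;
      rewrite wi0 ?(mul0r, mulr0, add0r, addr0);
    move=> /eqP; rewrite mulf_eq0 ?(negbTE s01) ?(negbTE s12) ?(negbTE s02) /= mulf_eq0;
    move=> /orP[/eqP wj0|/eqP wj0]; move: wE; rewrite wi0 wj0 !scale0r ?add0r ?addr0; exact: u3i.
exists (diag_mx w *m P0).
  rewrite unitmxE det_mulmx unitrM -!unitmxE uP0 andbT unitmxE unitfE det_diag.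
  by apply/prodf_neq0.
exists w; split=> [//|i|].
  by rewrite -rP0; apply/rowP => j; rewrite [RHS]mxE mul_diag_mx !mxE.
rewrite u3E mulmxA; congr (_ *m _); apply: row3P;
  by rewrite mxE sum_ord3 !mxE /= !mul1r ?mulr1n ?mulr0n ?add0r ?addr0.
Qed.

(** The set $U$ of the paper, on vectors. *)
Definition in_U (l : 'rV[C]_3) : Prop :=
  [/\ forall i, l 0 i != 0, l 0 0 != l 0 1, l 0 1 != l 0 2%:R & l 0 0 != l 0 2%:R].

(* The coefficients of a form [zdiag a b c] vanishing at [[1 : 1 : 1]] sum to 0; if the
   two forms of a pair are [zdiag a b c] and [- zdiag (l_2 a) (l_0 b) (l_1 c)], the two
   linear relations determine [a], [b], [c] up to a common factor. *)
Definition nf1 (l : 'rV[C]_3) :=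
  zdiag (l 0 1 - l 0 0) (l 0 2%:R - l 0 1) (l 0 0 - l 0 2%:R).

Definition nf2 (l : 'rV[C]_3) :=
  zdiag (l 0 2%:R * (l 0 0 - l 0 1)) (l 0 0 * (l 0 1 - l 0 2%:R))
        (l 0 1 * (l 0 2%:R - l 0 0)).

Lemma scale_zdiag k a b c : k *: zdiag a b c = zdiag (k * a) (k * b) (k * c).
Proof.
by apply/matrixP => i j; case: (ord3E i) => ->; case: (ord3E j) => ->; rewrite !mxE //= mulr0.
Qed.

Lemma four_points_nf (A B : 'M[C]_3) (u : nat -> 'rV[C]_3) :
  \det A != 0 -> \det B != 0 -> A^T = A -> B^T = B ->
  (forall i, (i < 4)%N -> u i != 0) ->
  (forall i j c, (i < 4)%N -> (j < 4)%N -> i != j -> u i != c *: u j) ->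
  (forall v, v != 0 -> (v *m A *m v^T = 0 /\ v *m B *m v^T = 0) <->
    exists2 i, (i < 4)%N & exists c, v = c *: u i) ->
  exists2 P : 'M[C]_3, P \in unitmx & exists l k,
    [/\ in_U l, k != 0, P *m A *m P^T = k *: nf1 l & P *m B *m P^T = k *: nf2 l].
Proof.
move=> dA dB At Bt u0 uI uAB.
have uA i : (i < 4)%N -> u i *m A *m (u i)^T = 0.
  by move=> i4; apply: (proj1 ((uAB _ (u0 _ i4)).2 _)); exists i => //; exists 1; rewrite scale1r.
have uB i : (i < 4)%N -> u i *m B *m (u i)^T = 0.
  by move=> i4; apply: (proj2 ((uAB _ (u0 _ i4)).2 _)); exists i => //; exists 1; rewrite scale1r.
have [P uP [w [w0 wu u3]]] := isotropic_frame dA At u0 uI uA.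
have dP : \det P != 0 by rewrite -unitfE -unitmxE.
have zd (M : 'M[C]_3) : \det M != 0 -> M^T = M ->
    (forall i, (i < 4)%N -> u i *m M *m (u i)^T = 0) ->
  exists a b c, [/\ P *m M *m P^T = zdiag a b c, a + b + c = 0, a != 0, b != 0 & c != 0].
  move=> dM Mt uM.
  have ME : P *m M *m P^T =
      zdiag ((P *m M *m P^T) 0 1) ((P *m M *m P^T) 1 2%:R) ((P *m M *m P^T) 0 2%:R).
    apply: zdiagP => [|i]; first by rewrite !trmx_mul trmxK Mt mulmxA.
    have -> : (P *m M *m P^T) i i = (row i P *m M *m (row i P)^T) 0 0.
      by rewrite -row_mul tr_row mxE [RHS]mxE; apply: eq_bigr => k _; rewrite !mxE.
    rewrite -wu linearZ /= -scalemxAr -!scalemxAl uM ?scaler0 ?mxE //.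
    by case: i => i /= /ltnW.
  move: ME; set a := (_ 0 1); set b := (_ 1 _); set c := (_ 0 2%:R) => ME.
  exists a, b, c.
  have : a * b * c != 0.
    have := congr1 determinant ME; rewrite !det_mulmx det_tr det_zdiag => dE.
    have : 2 * (a * b * c) != 0 by rewrite -dE !mulf_neq0.
    by rewrite mulf_eq0 negb_or => /andP[].
  rewrite !mulf_eq0 !negb_or => /andP[/andP[a0 b0] c0]; split=> //.
  have : row3 1 1 1 *m (P *m M *m P^T) *m (row3 1 1 1)^T = 0.
    by rewrite !mulmxA -u3 -mulmxA -trmx_mul -u3 uM.
  by rewrite ME => /isotropic_row3; rewrite !mxE /= !mulr1.
have [a [b [c [PA abc a0 b0 c0]]]] := zd _ dA At uA.
have [a' [b' [c' [PB abc' a'0 b'0 c'0]]]] := zd _ dB Bt uB.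
(* Proportional forms would define the same conic, on which a fifth common point [z] is
   exhibited. *)
have not_prop r : (a', b', c') <> (r * a, r * b, r * c).
  case=> ea eb ec.
  have [t [t0 t1 tab]] : exists t : C, [/\ t != 0, t != 1 & t * a + b != 0].
    have [h|h] := eqVneq (2 * a + b) 0; last first.
      by exists 2; split=> //; rewrite ?pnatr_eq0 // -subr_eq0 (_ : 2 - 1 = 1) ?oner_eq0 //; ring.
    exists 3; split; rewrite ?pnatr_eq0 //.
      by rewrite -subr_eq0 (_ : 3 - 1 = 2) ?pnatr_eq0 //; ring.
    have -> : 3 * a + b = (2 * a + b) + a by ring.
    by rewrite h add0r.
  (* The conic is parametrized by the lines [x = t z] through [[0 : 1 : 0]]. The conditions on [t]
     make all coordinates non-zero and avoid [[1 : 1 : 1]], which is the point of parameter 1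
     because [a + b + c = 0]. *)
  pose z := row3 (t * (t * a + b)) (- c * t) (t * a + b).
  have zA : z *m zdiag a b c *m z^T = 0.
    by apply/isotropic_row3; rewrite !mxE /=; ring.
  have zn0 : z != 0.
    by apply/eqP => /rowP/(_ 2%:R); rewrite !mxE /= => /eqP; rewrite (negbTE tab).
  have zP0 : z *m P != 0.
    by apply: contraNneq zn0 => zP; rewrite -[z](mulmxK uP) zP mul0mx.
  have zPM M : z *m P *m M *m (z *m P)^T = z *m (P *m M *m P^T) *m z^T.
    by rewrite trmx_mul !mulmxA.
  have zPA : z *m P *m A *m (z *m P)^T = 0 by rewrite zPM PA.
  have zPB : z *m P *m B *m (z *m P)^T = 0.
    by rewrite zPM PB ea eb ec -scale_zdiag -scalemxAr -scalemxAl zA scaler0.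
  have [i i4 [d zd0]] := (uAB _ zP0).1 (conj zPA zPB).
  have [i3|i3] := ltnP i 3; last first.
    have i3E : i = 3 by apply/eqP; rewrite eqn_leq i3 -ltnS i4.
    have zE : z = d *: row3 1 1 1.
      by rewrite -[z](mulmxK uP) zd0 i3E u3 -scalemxAl mulmxK.
    have z1 := congr1 (fun v : 'rV[C]_3 => v 0 0) zE.
    have z2 := congr1 (fun v : 'rV[C]_3 => v 0 2%:R) zE.
    move: z1 z2; rewrite !mxE /= mulr1 => <- /esym/eqP; rewrite -subr_eq0.
    rewrite -[X in _ - X]mul1r -mulrBl mulf_eq0 subr_eq0.
    by rewrite (negbTE t1) (negbTE tab).
  have zE : z = (d / w 0 (Ordinal i3)) *: delta_mx 0 (Ordinal i3).
    rewrite -[z](mulmxK uP) zd0 -[u i](scalerK (w0 (Ordinal i3))) (wu (Ordinal i3)).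
    by rewrite rowE !scalerA -scalemxAl mulmxK.
  have zi j : z 0 j != 0.
    by case: (ord3E j) => ->; rewrite !mxE /= ?mulf_neq0 // oppr_eq0.
  have [j ji] : exists j, j != Ordinal i3.
    by exists (if Ordinal i3 == 0 then 1 else 0); case: ifP => [/eqP->//|]; rewrite eq_sym => ->.
  by have := zi j; rewrite zE !mxE (negbTE ji) andbF mulr0 eqxx.
exists P => //.
(* The roots of the pencil are the opposites of the ratios of entries. The ratio at the entry (i, j)
   is indexed by the third index, so that permuting the basis permutes [l]. *)
have [l [ea eb ec]] : exists l : 'rV[C]_3,
    [/\ a' = - l 0 2%:R * a, b' = - l 0 0 * b & c' = - l 0 1 * c].
  by exists (row3 (- (b' / b)) (- (c' / c)) (- (a' / a))); rewrite !mxE /= !opprK !divfK.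
have cE : c = - (a + b) by apply/eqP; rewrite -subr_eq0 opprK addrC abc.
have lin : l 0 2%:R * a + l 0 0 * b + l 0 1 * c = 0.
  have : - (a' + b' + c') = 0 by rewrite abc' oppr0.
  by rewrite ea eb ec => <-; ring.
have r1 : (l 0 2%:R - l 0 1) * a = (l 0 1 - l 0 0) * b.
  by apply/eqP; rewrite -subr_eq0 -lin cE; apply/eqP; ring.
have r2 : (l 0 0 - l 0 2%:R) * a = (l 0 1 - l 0 0) * c.
  by apply/eqP; rewrite -subr_eq0 -(oppr_eq0 (_ - _)) -lin cE; apply/eqP; ring.
have l01 : l 0 0 != l 0 1.
  apply/eqP => l01; apply: (not_prop (- l 0 0)).
  by move/eqP: r1; rewrite l01 subrr mul0r mulf_eq0 (negbTE a0) orbF subr_eq0 => /eqP l21;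
      rewrite ea eb ec l21 l01.
have l10 : l 0 1 - l 0 0 != 0 by rewrite subr_eq0 eq_sym.
pose k := a / (l 0 1 - l 0 0).
have ka : a = k * (l 0 1 - l 0 0) by rewrite divfK.
have kb : b = k * (l 0 2%:R - l 0 1) by rewrite mulrC mulrA r1 mulrC mulKf.
have kc : c = k * (l 0 0 - l 0 2%:R) by rewrite mulrC mulrA r2 mulrC mulKf.
exists l, k; split.
- split=> //.
  + move=> i; case: (ord3E i) => ->; 
      [move: b'0; rewrite eb|move: c'0; rewrite ec|move: a'0; rewrite ea];
      by apply: contraNneq => ->; rewrite oppr0 mul0r.
  + by apply: contraNneq b0 => h; rewrite kb h subrr mulr0.
  + by apply: contraNneq c0 => h; rewrite kc h subrr mulr0.
- by rewrite mulf_neq0 ?invr_eq0.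
- by rewrite PA /nf1 scale_zdiag -ka -kb -kc.
- rewrite PB /nf2 scale_zdiag ea eb ec {1}ka {1}kb {1}kc; congr zdiag; ring.
Qed.

End Matrices3.

(** * Points, conics and roots of the pencil *)

Section Points.
Variable C : numClosedFieldType.

Lemma pi_proj_eq (V : normedModType C) (S : set V) (u v : nonzero_vec S) :
  (\pi_(Defs.proj S) u = \pi_(Defs.proj S) v) <-> exists2 c : C, c != 0 & val v = c *: val u.
Proof. by split=> [/eqmodP/asboolP//|h]; apply/eqmodP/asboolP. Qed.

Definition pt (v : 'rV[C]_3) : CP2 C := \pi_(CP2 C) (insubd (pt100 C) v).

Lemma val_insubd_pt100 (v : 'rV[C]_3) : v != 0 -> val (insubd (pt100 C) v) = v.
Proof. by move=> v0; rewrite insubdK //; apply/mem_set. Qed.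

Lemma pt_eq (u v : 'rV[C]_3) : u != 0 -> v != 0 ->
  pt u = pt v <-> exists2 c : C, c != 0 & v = c *: u.
Proof. by move=> u0 v0; rewrite /pt pi_proj_eq !val_insubd_pt100. Qed.

Lemma coords_neq0 (p : CP2 C) : coords p != 0.
Proof. by rewrite /coords; case: (repr p) => v /= /set_mem[]. Qed.

Lemma pt_coords (p : CP2 C) : pt (coords p) = p.
Proof.
rewrite -[RHS]reprK; apply/pi_proj_eq; exists 1; rewrite ?oner_eq0 //.
by rewrite val_insubd_pt100 ?coords_neq0 // scale1r.
Qed.

Lemma coords_pt (v : 'rV[C]_3) : v != 0 -> exists2 c : C, c != 0 & coords (pt v) = c *: v.
Proof. by move=> v0; apply/pt_eq; rewrite ?coords_neq0 ?pt_coords. Qed.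

Definition pt_S3 (v : 'rV[C]_3) : CP2_S3 C := \pi_(CP2_S3 C) (pt v).

Lemma pt_S3_eq (u v : 'rV[C]_3) : u != 0 -> v != 0 ->
  pt_S3 u = pt_S3 v <-> exists (s : 'S_3) (c : C), c != 0 /\ v = c *: col_perm s u.
Proof.
move=> u0 v0; have [c c0 cu] := coords_pt u0; have [d d0 dv] := coords_pt v0.
split=> [/eqmodP/asboolP[s [k [k0]]]|[s [k [k0 kuv]]]].
  rewrite cu dv => kuv; exists s, (d^-1 * (k * c)); split.
    by rewrite !mulf_neq0 // invr_eq0.
  apply/rowP => i; move/rowP/(_ i): kuv; rewrite !mxE => kuv.
  by rewrite -mulrA -mulrA -kuv mulKf.
apply/eqmodP/asboolP; exists s, (d * k * c^-1); split.
  by rewrite !mulf_neq0 // invr_eq0.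
by rewrite cu dv kuv; apply/rowP => i; rewrite !mxE -!mulrA mulKf.
Qed.

Lemma pt_S3_coords (p : CP2_S3 C) : pt_S3 (coords (repr p)) = p.
Proof. by rewrite /pt_S3 pt_coords reprK. Qed.

Lemma conic_mx_tr (c : conic C) : (conic_mx c)^T = conic_mx c.
Proof. by rewrite /conic_mx; case: (repr c) => v /= /set_mem[]. Qed.

Lemma conic_ofP (A : 'M[C]_3) : A^T = A -> A != 0 ->
  exists c : conic C, exists2 k : C, k != 0 & conic_mx c = k *: A.
Proof.
move=> At A0.
have h : A \in [set A : 'M[C]_3 | [set A : 'M[C]_3 | A^T = A] A /\ A != 0] by apply/mem_set.
exists (\pi_(conic C) (exist _ A h)).
by have /pi_proj_eq := esym (reprK (\pi_(conic C) (exist _ A h))).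
Qed.

Lemma on_conic_pt (c : conic C) (v : 'rV[C]_3) : v != 0 ->
  on_conic c (pt v) <-> v *m conic_mx c *m v^T = 0.
Proof.
move=> /coords_pt[k k0 kv]; rewrite /on_conic kv linearZ /= -scalemxAr -!scalemxAl.
split=> [/eqP|->]; last by rewrite !scaler0.
by rewrite !scaler_eq0 !(negbTE k0) => /eqP.
Qed.

Lemma in_U_neq0 (l : 'rV[C]_3) : in_U l -> l != 0.
Proof. by case=> l0 _ _ _; apply: contraNneq (l0 0) => ->; rewrite mxE. Qed.

(** The factor [c] is left free because the matrices of conics are only representatives up to
    scalars. *)
Definition pencil_roots (M : 'M[C]_3 * 'M[C]_3) (l : 'rV[C]_3) : Prop :=
  exists2 c : C, c != 0 & forall t,
    \det (t *: M.1 + M.2) = c * ((t - l 0 0) * (t - l 0 1) * (t - l 0 2%:R)).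

Definition pair_mx (x : OO C) := (conic_mx (val x).1, conic_mx (val x).2).

Lemma horner_det_pencil (A B : 'M[C]_3) t :
  (det_pencil A B).[t] = \det (t *: A + B).
Proof.
rewrite /det_pencil -horner_evalE -det_map_mx; congr determinant.
by apply/matrixP => i j; rewrite !mxE /= /horner_eval !hornerE.
Qed.

(** In characteristic 0 the difference vanishes at as many distinct natural numbers as its size. *)
Lemma poly_funext (p r : {poly C}) : (forall t, p.[t] = r.[t]) -> p = r.
Proof.
move=> pr; apply/eqP; rewrite -subr_eq0; apply/eqP.
apply: (@roots_geq_poly_eq0 _ _ [seq i%:R | i <- iota 0 (size (p - r))]).
- by apply/allP => _ /mapP[i _ ->]; rewrite rootE !hornerE pr subrr.
- by rewrite map_inj_uniq ?iota_uniq // => i j /eqP; rewrite eqr_nat => /eqP.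
- by rewrite size_map size_iota.
Qed.

(** [poly_roots] lists the roots in some unknown order; by unique factorization any other order is a
    permutation of it, invisible in the quotient by [S_3]. *)
Lemma root_pointE (x : OO C) (l : 'rV[C]_3) :
  pencil_roots (pair_mx x) l -> in_U l -> root_point x = pt_S3 l.
Proof.
move=> [c c0 xl] l_dist; rewrite /root_point.
set p := det_pencil _ _; set r := poly_roots p.
pose s := [:: l 0 0; l 0 1; l 0 2%:R].
have pE : p = c *: \prod_(z <- s) ('X - z%:P).
  apply: poly_funext => t; rewrite horner_det_pencil xl.
  by rewrite hornerZ horner_prod !big_cons big_nil !hornerXsubC mulr1 !mulrA.
have pr : perm_eq r s.
  apply: prod_XsubC_eq; apply: (scalerI c0); rewrite -pE.
  have -> : c = lead_coef p.
    by rewrite pE lead_coefZ (monicP (monic_prod_XsubC _ _ _)) mulr1.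
  by rewrite /r /poly_roots; case: closed_field_poly_normal.
have /tuple_permP[/= g gE] : perm_eq r [tuple of s] by [].
rewrite -[LHS]/(pt_S3 _); apply/esym/pt_S3_eq; first exact: in_U_neq0.
  apply/eqP => /rowP/(_ ((g^-1)%g 0)); rewrite !mxE gE.
  rewrite (nth_map 0) ?size_enum_ord // nth_ord_enum permKV (tnth_nth 0) /= => l0.
  by case: l_dist => /(_ 0); rewrite l0 eqxx.
exists g, 1; rewrite oner_neq0 scale1r; split=> //.
apply/rowP => i; rewrite !mxE gE.
rewrite (nth_map 0) ?size_enum_ord // nth_ord_enum (tnth_nth 0) /=.
by case: (ord3E (g i)) => ->.
Qed.

End Points.

(** * Orbits of pairs of conics, normal forms and classes of roots *)

Section Moduli.
Variable C : numClosedFieldType.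
Implicit Types (l : 'rV[C]_3) (M N : 'M[C]_3 * 'M[C]_3).

Lemma card_eq_seq (T : eqType) n (X : set T) : X #= `I_n <->
  exists s : seq T, [/\ size s = n, uniq s & forall p, X p <-> p \in s].
Proof.
elim: n X => [|n IH] X.
  rewrite II0 card_eq0; split=> [/eqP->|[s [/size0nil -> _ Xs]]]; first by exists [::]; split.
  by apply/eqP/seteqP; split=> p // /Xs.
split=> [/eq_cardSP[x Xx /IH[s [ss us Xs]]]|[[|x s] [//= [ss] /andP[xs us] Xs]]].
  exists (x :: s); split=> /=; first by rewrite ss.
    by rewrite us andbT; apply/negP => /Xs[_]; apply.
  move=> p; rewrite in_cons; case: eqVneq => [->|/eqP px] /=; first by [].
  by split=> [Xp|/Xs[]//]; apply/Xs.
apply/eq_cardSP; exists x; first by apply/Xs/mem_head.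
apply/IH; exists s; split=> // p; split=> [[/Xs + px]|ps].
  by rewrite in_cons => /predU1P[/px|].
split; first by apply/Xs; rewrite in_cons ps orbT.
by move=> px; move: xs; rewrite -px ps.
Qed.

Lemma uniq4 (T : eqType) (a b c d : T) : a != b -> a != c -> a != d ->
  b != c -> b != d -> c != d -> uniq [:: a; b; c; d].
Proof.
by move=> ab ac ad bc bd cd; rewrite /= !inE !negb_or ab ac ad bc bd cd.
Qed.

(** The two scalars are independent, each conic being projective on its own. With [P] on the left,
    its rows are the vectors of the new frame. *)
Definition congruent M N := exists2 P : 'M[C]_3, P \in unitmx &
  (exists2 k, k != 0 & N.1 = k *: (P *m M.1 *m P^T)) /\
  (exists2 k, k != 0 & N.2 = k *: (P *m M.2 *m P^T)).

Lemma congruent_sym M N : congruent M N -> congruent N M.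
Proof.
case=> P uP [[k k0 N1] [m m0 N2]]; exists (invmx P); first by rewrite unitmx_inv.
have E (A B : 'M[C]_3) (c : C) : c != 0 -> B = c *: (P *m A *m P^T) ->
    A = c^-1 *: (invmx P *m B *m (invmx P)^T).
  move=> c0 ->; rewrite -scalemxAr -scalemxAl scalerA mulVf // scale1r.
  rewrite -!mulmxA -trmx_mul mulVmx // trmx1 mulmx1 mulKmx //.
by split; [exists k^-1|exists m^-1]; rewrite ?invr_eq0 //; apply: E.
Qed.

Lemma congruent_trans M N K : congruent M N -> congruent N K -> congruent M K.
Proof.
case=> P uP [[k k0 N1] [m m0 N2]] [Q uQ [[k' k'0 K1] [m' m'0 K2]]].
exists (Q *m P); first by rewrite unitmx_mul uQ.
split; [exists (k' * k)|exists (m' * m)]; rewrite ?mulf_neq0 // ?K1 ?K2 ?N1 ?N2;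
  by rewrite -scalemxAr -scalemxAl scalerA trmx_mul !mulmxA.
Qed.

Lemma same_orbitP (x y : OO C) : same_orbit x y <-> congruent (pair_mx x) (pair_mx y).
Proof.
split=> [/asboolP[A [uA h1 h2]]|[P uP [h1 h2]]].
  by exists A^T; rewrite ?unitmx_tr // trmxK.
by apply/asboolP; exists P^T; rewrite unitmx_tr /congruent_by trmxK.
Qed.

Lemma in_UZ l k : k != 0 -> in_U l -> in_U (k *: l).
Proof.
move=> k0 [l0 l1 l2 l3]; split=> [i|||]; rewrite !mxE ?mulf_neq0 //;
  by rewrite (inj_eq (mulfI k0)).
Qed.

(** Scaling the two matrices by [k] and [m] multiplies the roots by [m / k], which is why only their
    projective class is an invariant. *)
Lemma pencil_roots_congruent M N l : congruent M N -> pencil_roots M l ->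
  exists2 k, k != 0 & pencil_roots N (k *: l).
Proof.
case=> P uP [[k k0 N1] [m m0 N2]] [c c0 Ml].
have dP : \det P != 0 by rewrite -unitfE -unitmxE.
exists (m / k); first by rewrite mulf_neq0 ?invr_eq0.
exists (k ^+ 3 * (\det P) ^+ 2 * c); first by rewrite !mulf_neq0 ?expf_neq0.
move=> t; rewrite N1 N2.
have -> : t *: (k *: (P *m M.1 *m P^T)) + m *: (P *m M.2 *m P^T) =
    m *: (P *m ((t * k / m) *: M.1 + M.2) *m P^T).
  rewrite mulmxDr mulmxDl scalerDr -scalemxAr -scalemxAl !scalerA; congr (_ *: _ + _).
  by rewrite mulrCA mulfV // mulr1.
rewrite detZ !det_mulmx det_tr Ml !mxE.
by field; rewrite k0 m0.
Qed.

Definition nf l := (nf1 l, nf2 l).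

Lemma pencil_roots_nf l : in_U l -> pencil_roots (nf l) l.
Proof.
case=> _ l01 l12 l02.
exists (2 * ((l 0 1 - l 0 0) * (l 0 2%:R - l 0 1) * (l 0 0 - l 0 2%:R))).
  by rewrite !mulf_neq0 ?pnatr_eq0 ?subr_eq0 // eq_sym.
move=> t /=; rewrite /nf1 /nf2 scale_zdiag.
have zdiagD a b c a' b' c' :
    zdiag a b c + zdiag a' b' c' = zdiag (a + a') (b + b') (c + c') :> 'M[C]_3.
  by apply/matrixP => i j; case: (ord3E i) => ->; case: (ord3E j) => ->; rewrite !mxE //= addr0.
by rewrite zdiagD det_zdiag; ring.
Qed.

Lemma OO_nf (x : OO C) : exists2 l, in_U l & congruent (pair_mx x) (nf l).
Proof.
case: x => -[c d] /= xO; rewrite /pair_mx /=; have [/= dc dd] := set_mem xO.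
move=> /card_eq_seq[s [ss us cds]].
have [P uP [l [k [l_dist k0 h1 h2]]]] : exists2 P : 'M[C]_3, P \in unitmx & exists l k,
    [/\ in_U l, k != 0, P *m conic_mx c *m P^T = k *: nf1 l &
        P *m conic_mx d *m P^T = k *: nf2 l].
  pose u i := coords (nth (pt 0) s i).
  apply: (@four_points_nf _ _ _ u) => //; rewrite ?conic_mx_tr //.
  - by move=> i _; exact: coords_neq0.
  - move=> i j e i4 j4; apply: contraNneq => /= uij.
    have /eqP : nth (pt 0) s i = nth (pt 0) s j.
      rewrite -[LHS]pt_coords -[RHS]pt_coords; apply/esym/pt_eq; rewrite ?coords_neq0 //.
      exists e => //; apply: contraTneq (coords_neq0 (nth (pt 0) s i)) => e0.
      by rewrite -/(u i) uij e0 scale0r eqxx.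
    by rewrite nth_uniq ?ss.
  - move=> v v0; have cdv : (v *m conic_mx c *m v^T = 0 /\ v *m conic_mx d *m v^T = 0) <->
      pt v \in s.
      by rewrite -cds /= !on_conic_pt.
    rewrite cdv; split=> [vs|[i i4 [e ve]]].
      exists (index (pt v) s); first by rewrite -ss index_mem.
      rewrite /u nth_index //; have [e e0 ->] := coords_pt v0.
      by exists e^-1; rewrite scalerA mulVf // scale1r.
    rewrite (_ : pt v = nth (pt 0) s i) ?mem_nth ?ss // -[RHS]pt_coords -/(u i).
    apply/esym/pt_eq; rewrite ?coords_neq0 //; exists e => //.
    by apply: contraNneq v0 => e0; rewrite ve e0 scale0r.
exists l => //; exists P => //; split; exists k^-1; rewrite ?invr_eq0 //=.
  by rewrite h1 scalerA mulVf // scale1r.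
by rewrite h2 scalerA mulVf // scale1r.
Qed.

Lemma nf_perm l (s : 'S_3) (k : C) : k != 0 -> congruent (nf l) (nf (k *: col_perm s l)).
Proof.
move=> k0; exists (perm_mx s); first exact: unitmx_perm.
have sE (A : 'M[C]_3) i j : (perm_mx s *m A *m (perm_mx s)^T) i j = A (s i) (s j).
  by rewrite -row_permE tr_perm_mx -col_permE !mxE.
(* [e] is the sign of [s]: the differences of coordinates in both normal forms are alternating. *)
have [e e0 [h1 h2]] : exists2 e : C, e != 0 &
    (forall i j, nf1 (col_perm s l) i j = e * nf1 l (s i) (s j)) /\
    (forall i j, nf2 (col_perm s l) i j = e * nf2 l (s i) (s j)).
  have s_inj i j : i != j -> s i != s j by rewrite (inj_eq perm_inj).
  have := s_inj 0 1 isT; have := s_inj 0 2%:R isT; have := s_inj 1 2%:R isT.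
  case: (ord3E (s 0)) => s0; case: (ord3E (s 1)) => s1; case: (ord3E (s 2%:R)) => s2;
    rewrite s0 s1 s2 // => _ _ _;
    (exists 1; [exact: oner_neq0|by split=> i j; case: (ord3E i) => ->; case: (ord3E j) => ->;
       rewrite ?s0 ?s1 ?s2 !mxE /= ?s0 ?s1 ?s2; ring]) ||
    (exists (- 1); [by rewrite oppr_eq0 oner_neq0|by split=> i j; case: (ord3E i) => ->;
        case: (ord3E j) => ->;
       rewrite ?s0 ?s1 ?s2 !mxE /= ?s0 ?s1 ?s2; ring]).
split; [exists (k * e)|exists (k ^+ 2 * e)]; rewrite ?mulf_neq0 ?expf_neq0 //; apply/matrixP =>
    i j.
  rewrite [RHS]mxE sE -mulrA -h1 /= /nf1 !mxE -!mulrBr.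
  by case: (ord3E i) => ->; case: (ord3E j) => -> /=; rewrite ?mulr0.
rewrite [RHS]mxE sE -mulrA -h2 /= /nf2 !mxE -!mulrBr.
by case: (ord3E i) => ->; case: (ord3E j) => -> /=; ring.
Qed.

(** Both directions pass through the normal form: a pair congruent to [nf l] has root point
    [pt_S3 l], and equal root points mean vectors equal up to permutation and scaling, whose normal
    forms are congruent by [nf_perm]. *)
Lemma root_point_same_orbit (x y : OO C) : same_orbit x y <-> root_point x = root_point y.
Proof.
rewrite same_orbitP.
have [l l_dist xl] := OO_nf x; have [m m_dist ym] := OO_nf y.
have xE (z : OO C) n : in_U n -> congruent (nf n) (pair_mx z) -> root_point z = pt_S3 n.
  move=> n_dist zn; have [k k0 zk] := pencil_roots_congruent zn (pencil_roots_nf n_dist).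
  rewrite (root_pointE zk (in_UZ k0 n_dist)); apply/esym/pt_S3_eq.
  - exact: in_U_neq0.
  - exact/in_U_neq0/in_UZ.
  by exists 1%g, k; rewrite col_perm1.
have xq := xE x l l_dist (congruent_sym xl); split=> [xy|].
  by rewrite xq; apply/esym/xE => //; apply: congruent_trans xy; apply: congruent_sym.
rewrite xq (xE y m m_dist (congruent_sym ym)).
move=> /(pt_S3_eq (in_U_neq0 l_dist) (in_U_neq0 m_dist))[s [k [k0 mE]]].
apply: congruent_trans xl _; apply: congruent_trans _ (congruent_sym ym).
by rewrite mE; apply: nf_perm.
Qed.

(** The pair is the normal form itself; the work is to show that its two conics meet in the four
    points of the standard frame and nowhere else. *)
Lemma OO_of_roots l : in_U l ->
    exists x : OO C, exists2 k, k != 0 & pencil_roots (pair_mx x) (k *: l).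
Proof.
move=> l_dist; have [l0 l01 l12 l02] := l_dist.
have zt a b c : (zdiag a b c : 'M[C]_3)^T = zdiag a b c.
  by apply/matrixP => i j; case: (ord3E i) => ->; case: (ord3E j) => ->; rewrite !mxE.
have d10 : l 0 1 - l 0 0 != 0 by rewrite subr_eq0 eq_sym.
have d21 : l 0 2%:R - l 0 1 != 0 by rewrite subr_eq0 eq_sym.
have d02 : l 0 0 - l 0 2%:R != 0 by rewrite subr_eq0.
have d1 : \det (nf1 l) != 0 by rewrite det_zdiag !mulf_neq0 ?pnatr_eq0.
have d2 : \det (nf2 l) != 0.
  by rewrite det_zdiag !mulf_neq0 ?pnatr_eq0 ?l0 // subr_eq0 // eq_sym.
have dn0 (A : 'M[C]_3) : \det A != 0 -> A != 0 by apply: contraNneq => ->; rewrite det0.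
have [c [k k0 ck]] := conic_ofP (zt _ _ _ : (nf1 l)^T = nf1 l) (dn0 _ d1).
have [d [m m0 dm]] := conic_ofP (zt _ _ _ : (nf2 l)^T = nf2 l) (dn0 _ d2).
have cdO : (c, d) \in transverse_pair (C := C).
  apply/mem_set; split=> /=.
  - by rewrite ck detZ mulf_neq0 ?expf_neq0.
  - by rewrite dm detZ mulf_neq0 ?expf_neq0.
  (* Opaque names, so that membership tests do not try to convert rows. *)
  have [w0 w0E] : exists w, w = row3 1 0 0 :> 'rV[C]_3 by eexists.
  have [w1 w1E] : exists w, w = row3 0 1 0 :> 'rV[C]_3 by eexists.
  have [w2 w2E] : exists w, w = row3 0 0 1 :> 'rV[C]_3 by eexists.
  have [w3 w3E] : exists w, w = row3 1 1 1 :> 'rV[C]_3 by eexists.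
  pose e := [:: w0; w1; w2; w3].
  have e0 w : w \in e -> w != 0.
    rewrite !inE => /or4P[]/eqP->; rewrite ?w0E ?w1E ?w2E ?w3E; apply/eqP;
      [move/rowP/(_ 0)/eqP|move/rowP/(_ 1)/eqP|move/rowP/(_ 2%:R)/eqP|move/rowP/(_ 0)/eqP];
      by rewrite !mxE oner_eq0.
  have pte u v i : u \in e -> v \in e -> (u 0 i == 0) != (v 0 i == 0) -> pt u != pt v.
    move=> ue ve; apply: contraNneq => /pt_eq-/(_ (e0 _ ue) (e0 _ ve))[a a0 ->].
    by rewrite !mxE mulf_eq0 (negbTE a0).
  apply/card_eq_seq; exists [seq pt v | v <- e]; split=> //.
    have we : [/\ w0 \in e, w1 \in e, w2 \in e & w3 \in e] by rewrite !inE !eqxx ?orbT.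
    case: we => ? ? ? ?; apply: uniq4.
    - by apply: (pte _ _ 0); rewrite // w0E w1E !mxE /= eqxx oner_eq0.
    - by apply: (pte _ _ 0); rewrite // w0E w2E !mxE /= eqxx oner_eq0.
    - by apply: (pte _ _ 1); rewrite // w0E w3E !mxE /= eqxx oner_eq0.
    - by apply: (pte _ _ 1); rewrite // w1E w2E !mxE /= eqxx oner_eq0.
    - by apply: (pte _ _ 0); rewrite // w1E w3E !mxE /= eqxx oner_eq0.
    - by apply: (pte _ _ 0); rewrite // w2E w3E !mxE /= eqxx oner_eq0.
  move=> p; rewrite -(pt_coords p) /=; move: (coords_neq0 p).
  set v := coords p => v0; rewrite !on_conic_pt // ck dm.
  have Z0 (A : 'M[C]_3) a : a != 0 -> v *m (a *: A) *m v^T = 0 <-> v *m A *m v^T = 0.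
    move=> a0; rewrite -scalemxAr -scalemxAl; split=> [/eqP|->]; last by rewrite scaler0.
    by rewrite scaler_eq0 (negbTE a0) => /eqP.
  rewrite !Z0 // !isotropic_row3; split; last first.
    move=> /(@mapP _ _ (@pt C) e)[w we /pt_eq-/(_ v0 (e0 _ we))[a a0 wE]].
    have vE : v = a^-1 *: w by rewrite wE scalerA mulVf // scale1r.
    by move: we; rewrite vE !inE => /or4P[]/eqP->; rewrite ?w0E ?w1E ?w2E ?w3E !mxE /=; split;
        ring.
  case=> h1 h2.
  suff [w we [a vw]] : exists2 w, w \in e & exists a, v = a *: w.
    apply/(@mapP _ _ (@pt C) e); exists w => //; apply/esym/pt_eq => //; first exact: e0.
    by exists a => //; apply: contraNneq v0 => a0; rewrite vw a0 scale0r.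
  have vP (a x y z : C) : v 0 0 = a * x -> v 0 1 = a * y -> v 0 2%:R = a * z ->
      v = a *: row3 x y z.
    by move=> vx vy vz; apply: row3P; rewrite !mxE.
  (* For [z] a root of the pencil this combination is a degenerate conic. The roots [l 0 0] and
     [l 0 2%:R] give, after division, [xy = xz] and [yz = xz]. *)
  have comb z :
      z * ((l 0 1 - l 0 0) * (v 0 0 * v 0 1) + (l 0 2%:R - l 0 1) * (v 0 1 * v 0 2%:R) +
          (l 0 0 - l 0 2%:R) * (v 0 0 * v 0 2%:R))
      + (l 0 2%:R * (l 0 0 - l 0 1) * (v 0 0 * v 0 1) +
          l 0 0 * (l 0 1 - l 0 2%:R) * (v 0 1 * v 0 2%:R) +
              l 0 1 * (l 0 2%:R - l 0 0) * (v 0 0 * v 0 2%:R)) = 0.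
    by rewrite h1 h2 mulr0 addr0.
  have XZ : v 0 0 * v 0 1 = v 0 0 * v 0 2%:R.
    apply/eqP; rewrite -subr_eq0; apply/eqP; apply: (mulfI (mulf_neq0 d10 d02)).
    by rewrite mulr0 -(comb (l 0 0)); ring.
  have YZ : v 0 1 * v 0 2%:R = v 0 0 * v 0 2%:R.
    apply/eqP; rewrite -subr_eq0; apply/eqP; apply: (mulfI (mulf_neq0 d21 d02)).
    by rewrite mulr0 -[RHS]oppr0 -(comb (l 0 2%:R)); ring.
  have [x0|x0] := eqVneq (v 0 0) 0.
    move/eqP: YZ; rewrite x0 mul0r mulf_eq0 => /orP[/eqP y0|/eqP z0].
      exists w2; first by rewrite !inE eqxx ?orbT.
      rewrite w2E; by exists (v 0 2%:R); apply: vP; rewrite ?mulr0 ?mulr1.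
    exists w1; first by rewrite !inE eqxx ?orbT.
    rewrite w1E; by exists (v 0 1); apply: vP; rewrite ?mulr0 ?mulr1.
  have yz := mulfI x0 XZ; move: YZ; rewrite -yz => /eqP.
  rewrite -subr_eq0 -mulrBl mulf_eq0 subr_eq0 => /orP[/eqP yx|/eqP y0].
    exists w3; first by rewrite !inE eqxx ?orbT.
    rewrite w3E; by exists (v 0 0); apply: vP; rewrite ?mulr1 -?yz ?yx.
  exists w0; first by rewrite !inE eqxx.
  rewrite w0E; by exists (v 0 0); apply: vP; rewrite ?mulr0 ?mulr1 -?yz.
exists (exist _ (c, d) cdO).
apply: (pencil_roots_congruent _ (pencil_roots_nf l_dist)); exists 1%:M; first exact: unitmx1.
by rewrite trmx1 !mul1mx !mulmx1; split; [exists k|exists m].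
Qed.

End Moduli.

(** * The Cayley condition *)

Section Cayley.
Variable C : numClosedFieldType.

Lemma root_prod_ordP n (s : 'I_n -> C) x :
  reflect (exists i, x = s i) (root (\prod_(i < n) ('X - (s i)%:P)) x).
Proof.
have -> : \prod_(i < n) ('X - (s i)%:P) = \prod_(z <- [seq s i | i <- enum 'I_n]) ('X - z%:P).
  by rewrite big_map big_enum.
rewrite root_prod_XsubC; apply: (iffP mapP) => [[i _ ->]|[i ->]]; exists i => //.
by rewrite mem_enum.
Qed.

Lemma differentiable_idfun (s : C) : differentiable (fun z : C => z : C^o) s.
Proof. exact/derivable1_diffP/derivable_id. Qed.

Lemma differentiable_const (a s : C) : differentiable (fun z : C => a : C^o) s.
Proof. exact: (differentiable_cst (a : C^o)). Qed.

Section Diff.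
Variables (V : normedModType C) (f g : V -> C^o) (x : V).
Hypotheses (df : differentiable f x) (dg : differentiable g x).

Lemma differentiable_add : differentiable (fun y => f y + g y : C^o) x.
Proof. exact: differentiableD. Qed.
Lemma differentiable_sub : differentiable (fun y => f y - g y : C^o) x.
Proof. exact: differentiableB. Qed.
Lemma differentiable_mul : differentiable (fun y => f y * g y : C^o) x.
Proof. exact: (@differentiableM _ _ f g). Qed.
Lemma differentiable_exp n : differentiable (fun y => f y ^+ n : C^o) x.
Proof.
elim: n => [|n IH]; first exact: (differentiable_cst (1 : C^o)).
rewrite (_ : (fun y => _) = (fun y => f y * f y ^+ n : C^o)).
  exact: (@differentiableM _ _ f _).
by apply/funext => y; rewrite exprS.
Qed.
Lemma differentiable_div : g x != 0 -> differentiable (fun y => f y / g y : C^o) x.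
Proof. by move=> gx; apply: (@differentiableM _ _ f _ _) => //; apply: differentiableV. Qed.
End Diff.

(** The Horner form lets [is_derive_horner] differentiate one level at a time. *)
Definition cubic (a0 a1 a2 a3 : C) (t : C) : C^o := a0 + t * (a1 + t * (a2 + t * a3)).

Lemma is_derive_horner (f : C -> C^o) (a t df : C) :
  is_derive t 1 f df -> is_derive t 1 (fun z => a + z * f z : C^o) (f t + t * df : C^o).
Proof.
move=> fdf.
have H := is_deriveD (is_derive_cst (a : C^o) t 1) (is_deriveM (is_derive_id (t : C^o) 1) fdf).
apply: (is_derive_eq H).
rewrite add0r addrC /GRing.scale /=; ring.
Qed.

Lemma is_derive_cubic a0 a1 a2 a3 (t : C) :
  is_derive t 1 (cubic a0 a1 a2 a3) (a1 + t * (2 * a2 + t * (3 * a3)) : C^o).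
Proof.
have H := is_derive_horner a0 (is_derive_horner a1 (is_derive_horner a2
  (is_derive_cst (a3 : C^o) t 1))).
by apply: (is_derive_eq H) => /=; ring.
Qed.

(* Differentiating [s ^+ 2 = p] twice gives [s s'' = p'' / 2 - s' ^+ 2], where
   [2 s s' = p']. *)
Lemma sqrt_cubic_coef2 (a0 a1 a2 a3 : C) (s : C -> C^o) : a0 != 0 ->
  (\forall t \near (0 : C), derivable s t 1) ->
  (\forall t \near (0 : C), s t ^+ 2 = cubic a0 a1 a2 a3 t) ->
  s^`(2)%classic 0 / (2`!)%:R = 0 <-> a1 ^+ 2 = 4 * a0 * a2.
Proof.
move=> a00 ds sp.
have s0E : s 0 ^+ 2 = a0 by rewrite (nbhs_singleton sp) /cubic mul0r addr0.
have s00 : s 0 != 0 by apply: contraNneq a00; rewrite -s0E => ->; rewrite expr0n.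
have sn0 : \forall t \near (0 : C), s t != 0.
  have sc : {for (0 : C), continuous s}.
    by apply: differentiable_continuous; apply/derivable1_diffP; exact: nbhs_singleton ds.
  have := @cvgr_neq0 _ _ _ (nbhs (0 : C)) _ s _ sc s00; exact.
have sE : \forall t \near (0 : C),
    s^`()%classic t = (a1 + t * (2 * a2 + t * (3 * a3))) / (2 * s t).
  apply: filterS (filterI (nbhs_interior sp) (filterI ds sn0)) => t [spt [dst st0]].
  have H := is_deriveM (derivableP dst) (derivableP dst).
  have E : 'D_1 (s * s) t = 'D_1 (cubic a0 a1 a2 a3) t.
    by apply: near_eq_derive; apply: filterS spt => z; rewrite expr2.
  have [_] := H; rewrite E; have [_ ->] := is_derive_cubic a0 a1 a2 a3 t.
  rewrite derive1E /GRing.scale /= => ->.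
  by field.
set u := s^`()%classic in sE *.
(* [s] is assumed differentiable only once; its derivative [u] is differentiable because it equals
   [p' / (2 s)] near 0. *)
have du : derivable u 0 1.
  have sE' : \forall t \near (0 : C), (a1 + t * (2 * a2 + t * (3 * a3))) / (2 * s t) = u t.
    by apply: filterS sE => t ->.
  apply: (near_eq_derivable sE').
  apply/derivable1_diffP/differentiable_div; last by rewrite mulf_neq0 ?pnatr_eq0.
    apply/derivable1_diffP; have [] :=
        is_derive_horner a1 (is_derive_horner (2 * a2) (is_derive_cst (3 * a3 : C^o) (0 : C) 1)).
    exact.
  apply: differentiable_mul; first exact: (differentiable_cst (2 : C^o)).
  by apply/derivable1_diffP; exact: nbhs_singleton ds.
have u0 : 2 * s 0 * u 0 = a1.
  by rewrite (nbhs_singleton sE) mul0r addr0 mulrC divfK // mulf_neq0 ?pnatr_eq0.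
have E1 : s 0 * 'D_1 u 0 + u 0 ^+ 2 = a2.
  have H := is_deriveM (derivableP (nbhs_singleton ds)) (derivableP du).
  have E : 'D_1 (s * u) 0 =
      'D_1 (fun t : C => 2^-1 * a1 + t * (a2 + t * (2^-1 * (3 * a3))) : C^o) 0.
    apply: near_eq_derive; apply: filterS (filterI sE sn0) => t [ut st0].
    by rewrite -[LHS]/(s t * u t) ut; field.
  have [_] := H; rewrite E.
  have [_ ->] := is_derive_horner (2^-1 * a1) (is_derive_horner a2
    (is_derive_cst (2^-1 * (3 * a3) : C^o) (0 : C) 1)).
  by rewrite /GRing.scale /= !mul0r !addr0 -(derive1E s) -/u => ->; rewrite expr2.
rewrite derive1nS derive1n1 -/u derive1E.
have -> : 'D_1 u 0 / (2`!)%:R = 0 <-> s 0 * 'D_1 u 0 = 0.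
  split=> /eqP; rewrite mulf_eq0 ?invr_eq0 ?pnatr_eq0 ?(negbTE s00) /= ?orbF => /eqP ->;
    by rewrite ?mulr0 ?mul0r.
have -> : a1 ^+ 2 = 4 * a0 * (u 0 ^+ 2) by rewrite -u0 -s0E; ring.
rewrite -E1; split=> [->|/(mulfI _) h]; first by rewrite add0r.
apply: (addIr (u 0 ^+ 2)); rewrite add0r -h // mulf_neq0 ?pnatr_eq0 //.
Qed.

(** A branch of the square root is one of the two roots of [X^2 - p(t)]; these are distinct at
    [t = 0] because [a0] is not 0, so [differentiable_roots] applies. *)
Lemma sqrt_cubic_exists (a0 a1 a2 a3 : C) : a0 != 0 -> exists s : C -> C^o,
  (\forall t \near (0 : C), derivable s t 1) /\
  (\forall t \near (0 : C), s t ^+ 2 = cubic a0 a1 a2 a3 t).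
Proof.
move=> a00; pose P t : {poly C} := 'X^2 - (cubic a0 a1 a2 a3 t)%:P.
have Ps t : size (P t) = 3 by rewrite size_XnsubC.
have Pm t : P t \is monic by rewrite monicXnsubC.
pose r (i : 'I_2) := if i == 0 then sqrtC a0 else - sqrtC a0.
have p0 : cubic a0 a1 a2 a3 0 = a0 by rewrite /cubic mul0r addr0.
have [||i|s _ [e _ sP]] := @differentiable_roots _ 2 P 0 r Pm Ps.
- apply: filterE => t k; apply/derivable1_diffP.
  have dp : derivable (cubic a0 a1 a2 a3) t 1 by have [] := is_derive_cubic a0 a1 a2 a3 t.
  rewrite (_ : (fun y => _) = (fun y =>
      (k == 2)%:R - (if k is 0%N then cubic a0 a1 a2 a3 y else 0) : C^o)).
    by apply: derivableB; [exact: derivable_cst|case: k => [//|k]; exact: derivable_cst].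
  by apply/funext => y; rewrite coefB coefXn coefC; case: k.
- have w0 : sqrtC a0 != - sqrtC a0.
    by rewrite -subr_eq0 opprK -mulr2n mulrn_eq0 /= sqrtC_eq0.
  by case=> [[|[|//]] hi] [[|[|//]] hj]; rewrite /r /= => /eqP;
      rewrite ?(negbTE w0) 1?eq_sym ?(negbTE w0) // => _;
    apply/val_inj.
- by rewrite rootE !hornerE p0 /r; case: ifP; rewrite ?sqrrN sqrtCK subrr.
exists (s 0); split; apply: filterS sP => t [Pt _ ds]; first exact/derivable1_diffP/ds.
have : root (P t) (s 0 t) by rewrite Pt; apply/root_prod_ordP; exists 0.
by rewrite rootE !hornerE subr_eq0 => /eqP.
Qed.

Definition esym1 (l : 'rV[C]_3) : C := l 0 0 + l 0 1 + l 0 2%:R.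
Definition esym2 (l : 'rV[C]_3) : C :=
  l 0 0 * l 0 1 + l 0 1 * l 0 2%:R + l 0 0 * l 0 2%:R.
Definition esym3 (l : 'rV[C]_3) : C := l 0 0 * l 0 1 * l 0 2%:R.

(** The pencil has coefficients [- c e3], [c e2], [- c e1], [c], so the condition
    [a1 ^+ 2 = 4 * a0 * a2] becomes the equation in the symmetric functions. *)
Lemma cayleyP (x : OO C) l : pencil_roots (pair_mx x) l -> in_U l ->
  cayley x <-> esym2 l ^+ 2 = 4 * esym1 l * esym3 l.
Proof.
move=> [c c0 xl] [l0 _ _ _].
have cubE t : \det (t *: conic_mx (val x).1 + conic_mx (val x).2) =
    cubic (- (c * esym3 l)) (c * esym2 l) (- (c * esym1 l)) c t.
  by rewrite xl /cubic /esym1 /esym2 /esym3; ring.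
have a00 : - (c * esym3 l) != 0 by rewrite oppr_eq0 !mulf_neq0.
have E : esym2 l ^+ 2 = 4 * esym1 l * esym3 l <->
    (c * esym2 l) ^+ 2 = 4 * (- (c * esym3 l)) * (- (c * esym1 l)).
  rewrite exprMn; split=> [->|h]; first by ring.
  by apply: (mulfI (expf_neq0 2 c0)); rewrite h; ring.
rewrite E; split=> [[s [ds sp s2]]|h].
  apply: (sqrt_cubic_coef2 a00 ds _).1 s2.
  by apply: filterS sp => t ->.
have [s [ds sp]] := sqrt_cubic_exists (c * esym2 l) (- (c * esym1 l)) c a00.
exists s; split=> //; last by apply/(sqrt_cubic_coef2 a00 ds sp).
by apply: filterS sp => t ->.
Qed.

End Cayley.

(** * The Cayley curve in symmetric functions *)

Section CurveAlgebra.
Variable C : numClosedFieldType.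
Implicit Types (l : 'rV[C]_3).

Lemma perm3_cases (s : 'S_3) (P : 'I_3 -> 'I_3 -> 'I_3 -> Prop) :
  P 0 1 2%:R -> P 0 2%:R 1 -> P 1 0 2%:R -> P 1 2%:R 0 -> P 2%:R 0 1 -> P 2%:R 1 0 ->
  P (s 0) (s 1) (s 2%:R).
Proof.
have s_inj i j : i != j -> s i != s j by rewrite (inj_eq perm_inj).
have := s_inj 0 1 isT; have := s_inj 0 2%:R isT; have := s_inj 1 2%:R isT.
by case: (ord3E (s 0)) => ->; case: (ord3E (s 1)) => ->; case: (ord3E (s 2%:R)) => ->.
Qed.

Lemma esym_perm (s : 'S_3) l : [/\ esym1 (col_perm s l) = esym1 l,
  esym2 (col_perm s l) = esym2 l & esym3 (col_perm s l) = esym3 l].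
Proof.
rewrite /esym1 /esym2 /esym3 !mxE.
by elim/(perm3_cases s): _; split; ring.
Qed.

Lemma esymZ (c : C) l : [/\ esym1 (c *: l) = c * esym1 l,
  esym2 (c *: l) = c ^+ 2 * esym2 l & esym3 (c *: l) = c ^+ 3 * esym3 l].
Proof. by rewrite /esym1 /esym2 /esym3 !mxE; split; ring. Qed.

Lemma esym_roots l t : (t - l 0 0) * (t - l 0 1) * (t - l 0 2%:R) =
  t ^+ 3 - esym1 l * t ^+ 2 + esym2 l * t - esym3 l.
Proof. by rewrite /esym1 /esym2 /esym3; ring. Qed.

(** Each coordinate of [m] is a root of the cubic with roots [l]; as the coordinates of [m] are
    distinct, the matching of indices is injective, hence a permutation. *)
Lemma esym_inj l m : in_U m -> esym1 l = esym1 m -> esym2 l = esym2 m ->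
  esym3 l = esym3 m -> exists s : 'S_3, m = col_perm s l.
Proof.
case=> _ m01 m12 m02 h1 h2 h3.
have root_m (i : 'I_3) : exists j, m 0 i = l 0 j.
  have := esym_roots l (m 0 i); rewrite h1 h2 h3 -esym_roots => /eqP.
  have -> : (m 0 i - m 0 0) * (m 0 i - m 0 1) * (m 0 i - m 0 2%:R) = 0.
    by case: (ord3E i) => ->; rewrite subrr ?(mul0r, mulr0).
  rewrite !mulf_eq0 !subr_eq0 -orbA => /or3P[]/eqP->; by eexists.
have [f fE] := fin_all_exists root_m.
have f_inj : injective f.
  have m_inj i j : m 0 i = m 0 j -> i = j.
    by case: (ord3E i) => ->; case: (ord3E j) => -> // /eqP;
       rewrite ?(negbTE m01) ?(negbTE m12) ?(negbTE m02) //
               eq_sym ?(negbTE m01) ?(negbTE m12) ?(negbTE m02).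
  by move=> i j fij; apply: m_inj; rewrite !fE fij.
exists (perm f_inj); apply/rowP => i; by rewrite mxE permE fE.
Qed.

(** The discriminant of [X^3 - e1 X^2 + e2 X - e3]. *)
Definition disc3 (e1 e2 e3 : C) : C := e1 ^+ 2 * e2 ^+ 2 - 4 * e2 ^+ 3
  - 4 * e1 ^+ 3 * e3 + 18 * e1 * e2 * e3 - 27 * e3 ^+ 2.

Lemma disc3E l : (l 0 0 - l 0 1) ^+ 2 * (l 0 0 - l 0 2%:R) ^+ 2 * (l 0 1 - l 0 2%:R) ^+ 2
  = disc3 (esym1 l) (esym2 l) (esym3 l).
Proof. by rewrite /disc3 /esym1 /esym2 /esym3; ring. Qed.

Lemma in_U_esym l : in_U l <-> esym3 l != 0 /\ disc3 (esym1 l) (esym2 l) (esym3 l) != 0.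
Proof.
split=> [[l0 l01 l12 l02]|[l0]].
  by rewrite -disc3E /esym3 !mulf_neq0 ?expf_neq0 ?subr_eq0.
rewrite -disc3E => d; split.
- by move=> i; apply: contraNneq l0; rewrite /esym3; case: (ord3E i) => -> ->;
    rewrite ?(mulr0, mul0r).
- by apply: contraNneq d => ->; rewrite subrr expr0n /= !mul0r.
- by apply: contraNneq d => ->; rewrite subrr expr0n /= mulr0.
- by apply: contraNneq d => ->; rewrite subrr expr0n /= mulr0 mul0r.
Qed.

Lemma jfunE l : jfun l =
  256 * (esym1 l ^+ 2 - 3 * esym2 l) ^+ 3 / disc3 (esym1 l) (esym2 l) (esym3 l).
Proof.
rewrite /jfun disc3E; congr (256 * _ ^+ 3 / _).
by rewrite /esym1 /esym2; ring.
Qed.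

Lemma jfun_orbit (s : 'S_3) (c : C) l : c != 0 -> jfun (c *: col_perm s l) = jfun l.
Proof.
move=> c0; rewrite !jfunE.
have [-> -> ->] := esymZ c (col_perm s l); have [-> -> ->] := esym_perm s l.
rewrite (_ : disc3 _ _ _ = c ^+ 6 * disc3 (esym1 l) (esym2 l) (esym3 l)); last first.
  by rewrite /disc3; ring.
rewrite (_ : 256 * _ ^+ 3 = c ^+ 6 * (256 * (esym1 l ^+ 2 - 3 * esym2 l) ^+ 3)); last by ring.
by rewrite -mulf_div divff ?expf_neq0 // mul1r.
Qed.

Definition sratio l : C := esym2 l / esym1 l ^+ 2.

Lemma sratio_orbit (s : 'S_3) (c : C) l : c != 0 -> sratio (c *: col_perm s l) = sratio l.
Proof.
move=> c0; rewrite /sratio; have [-> -> _] := esymZ c (col_perm s l); have [-> -> _] :=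
    esym_perm s l.
by rewrite exprMn -mulf_div divff ?expf_neq0 // mul1r.
Qed.

Lemma coords_pt_S3 l : l != 0 ->
  exists (s : 'S_3) (c : C), c != 0 /\ coords (repr (pt_S3 l)) = c *: col_perm s l.
Proof. by move=> l0; apply/pt_S3_eq; rewrite ?coords_neq0 ?pt_S3_coords. Qed.

Lemma jfun_pt_S3 l : l != 0 -> jfun (coords (repr (pt_S3 l))) = jfun l.
Proof. by move=> /coords_pt_S3[s [c [c0 ->]]]; rewrite jfun_orbit. Qed.

Lemma sratio_pt_S3 l : l != 0 -> sratio (coords (repr (pt_S3 l))) = sratio l.
Proof. by move=> /coords_pt_S3[s [c [c0 ->]]]; rewrite sratio_orbit. Qed.

Lemma esym1_pt_S3 l : l != 0 -> (esym1 (coords (repr (pt_S3 l))) == 0) = (esym1 l == 0).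
Proof.
move=> /coords_pt_S3[s [c [c0 ->]]].
have [-> _ _] := esymZ c (col_perm s l); have [-> _ _] := esym_perm s l.
by rewrite mulf_eq0 (negbTE c0).
Qed.

Definition cayley_eq l := esym2 l ^+ 2 = 4 * esym1 l * esym3 l.

Lemma cayley_eqZ (k : C) l : k != 0 -> cayley_eq (k *: l) <-> cayley_eq l.
Proof.
move=> k0; rewrite /cayley_eq; have [-> -> ->] := esymZ k l.
split=> [h|h]; last by rewrite exprMn h; ring.
apply: (mulfI (expf_neq0 4 k0)).
have -> : k ^+ 4 * esym2 l ^+ 2 = (k ^+ 2 * esym2 l) ^+ 2 by ring.
by rewrite h; ring.
Qed.

Lemma moduliP (m : MM C) : exists l, [/\ in_U l, moduli m = pt_S3 l,
  pi_cayley m <-> cayley_eq l & jbar m = jfun l].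
Proof.
have [l0 l0_dist ml0] := OO_nf (repr m).
have [k k0 ml] := pencil_roots_congruent (congruent_sym ml0) (pencil_roots_nf l0_dist).
set l := k *: l0 in ml; have l_dist : in_U l by exact: in_UZ.
have mq : moduli m = pt_S3 l by exact: root_pointE ml l_dist.
exists l; split=> //; last by rewrite /jbar mq jfun_pt_S3 // in_U_neq0.
(* [pi_cayley] is an image, so every pair of the orbit has to be considered: its roots are
   proportional to [l], and the equation of the curve is homogeneous. *)
have yP (y : OO C) : \pi_(MM C) y = m -> cayley y <-> cayley_eq l.
  move=> ym; have /eqmodP/(same_orbitP (C := C)) my : repr m = y %[mod MM C] by rewrite reprK ym.
  have [k' k'0 yl] := pencil_roots_congruent my ml.
  exact: iff_trans (cayleyP yl (in_UZ k'0 l_dist)) (cayley_eqZ l k'0).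
split=> [[y cy ym]|lc]; first by apply/(yP y).
by exists (repr m); [apply/yP|]; rewrite ?reprK.
Qed.

Lemma moduli_inj : injective (@moduli C).
Proof.
move=> m n /root_point_same_orbit mn; rewrite -[m]reprK -[n]reprK.
exact/eqmodP.
Qed.

Lemma moduli_surj l : in_U l -> exists m : MM C, moduli m = pt_S3 l.
Proof.
move=> l_dist; have [x [k k0 xl]] := OO_of_roots l_dist.
exists (\pi_(MM C) x).
have <- : root_point x = pt_S3 l.
  rewrite (root_pointE xl (in_UZ k0 l_dist)); apply/esym/pt_S3_eq.
  - exact: in_U_neq0.
  - exact/in_U_neq0/in_UZ.
  by exists 1%g, k; rewrite col_perm1.
apply/esym/root_point_same_orbit.
by apply/eqmodP; rewrite reprK.
Qed.

(** The function $\overline j$ on the Cayley curve in the coordinate $s = e_2 / e_1^2$. *)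
Definition jpar (s : C) : C := 4096 * (1 - 3 * s) ^+ 3 / (s ^+ 3 * (8 - 27 * s)).

Definition qpol (s : C) : C := 27 * s ^+ 2 - 36 * s + 8.

(* The range of the coordinate $s$ on the Cayley curve minus $S$. *)
Definition good : set C :=
  [set s | s * (8 - 27 * s) * ((1 - 3 * s) * qpol s) != 0].

Lemma jpar_1728 s : s * (8 - 27 * s) != 0 ->
  jpar s - 1728 = 64 * qpol s ^+ 2 / (s ^+ 3 * (8 - 27 * s)).
Proof.
rewrite mulf_eq0 negb_or => /andP[s0 s8]; rewrite /jpar /qpol; field.
by rewrite s0 s8.
Qed.

Lemma goodP s : s * (8 - 27 * s) != 0 -> good s <-> jpar s != 0 /\ jpar s != 1728.
Proof.
move=> s0; have := s0; rewrite mulf_eq0 negb_or => /andP[s1 s2].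
rewrite /good /= mulf_eq0 negb_or s0 /= -(subr_eq0 _ 1728) jpar_1728 //.
rewrite /jpar !(invr_eq0, expf_eq0, mulf_eq0) /= !pnatr_eq0 /=.
by rewrite (negbTE s1) (negbTE s2) !orbF negb_or; split=> [/andP|] [-> ->].
Qed.

(** The zeros 0 and 8/27 of the discriminant along the curve are the poles of [jpar], and its
    denominator 16 turns the 256 of [jfun] into 4096. *)
Lemma disc3_cayley (e1 s : C) : disc3 e1 (s * e1 ^+ 2) (s ^+ 2 * e1 ^+ 3 / 4) =
  e1 ^+ 6 * (s ^+ 3 * (8 - 27 * s)) / 16.
Proof. by rewrite /disc3; field. Qed.

Lemma cayley_esym l : cayley_eq l -> esym1 l != 0 ->
  esym2 l = sratio l * esym1 l ^+ 2 /\ esym3 l = sratio l ^+ 2 * esym1 l ^+ 3 / 4.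
Proof.
move=> lc e0; split; first by rewrite /sratio divfK ?expf_neq0.
rewrite /sratio expr_div_n lc; field.
by rewrite e0.
Qed.

Lemma cayley_jfun l : in_U l -> cayley_eq l -> esym1 l != 0 ->
  sratio l * (8 - 27 * sratio l) != 0 /\ jfun l = jpar (sratio l).
Proof.
move=> /in_U_esym[_ d0] lc e0; have [h2 h3] := cayley_esym lc e0.
rewrite jfunE; move: d0; rewrite h2 h3 disc3_cayley.
move: (sratio l) (esym1 l) e0 => s e e0.
rewrite !(invr_eq0, expf_eq0, mulf_eq0) /= (negbTE e0) pnatr_eq0 orbF /=.
rewrite negb_or => /andP[s0 s8]; split; first by rewrite ?negb_or ?s0 ?mulf_neq0.
rewrite /jpar; field.
by rewrite e0 s0 s8.
Qed.

Lemma curve_good l : in_U l -> cayley_eq l -> jfun l != 0 -> jfun l != 1728 ->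
  esym1 l != 0 /\ good (sratio l).
Proof.
move=> l_dist lc j0 j1728; have e0 : esym1 l != 0.
  apply: contraNneq j0 => e0; move: lc; rewrite /cayley_eq e0 mulr0 mul0r => /eqP.
  by rewrite expf_eq0 /= jfunE e0 => /eqP ->; rewrite mulr0 subr0 !expr0n /= mulr0 mul0r.
split=> //; have [s0 jE] := cayley_jfun l_dist lc e0.
by apply/goodP => //; rewrite -jE.
Qed.

Lemma good_curve l s : good s -> esym1 l = 1 -> esym2 l = s -> esym3 l = s ^+ 2 / 4 ->
  [/\ in_U l, cayley_eq l, sratio l = s, jfun l != 0 & jfun l != 1728].
Proof.
move=> sT h1 h2 h3.
have s0 : s * (8 - 27 * s) != 0 by move: sT; rewrite /good /= mulf_eq0 negb_or => /andP[].
have := s0; rewrite mulf_eq0 negb_or => /andP[s1 s2].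
have l_sig : sratio l = s by rewrite /sratio h1 h2 expr1n divr1.
have lc : cayley_eq l by rewrite /cayley_eq h1 h2 h3; field.
have l_dist : in_U l.
  apply/in_U_esym; rewrite h3; split; first by rewrite mulf_neq0 ?expf_neq0 ?invr_eq0 ?pnatr_eq0.
  have := disc3_cayley 1 s; rewrite h1 h2 !expr1n !mulr1 mul1r => ->.
  by rewrite !mulf_neq0 ?expf_neq0 ?invr_eq0 ?pnatr_eq0.
have e0 : esym1 l != 0 by rewrite h1 oner_eq0.
have [_ ->] := cayley_jfun l_dist lc e0.
by rewrite l_sig; have [] := (goodP s0).1 sT.
Qed.

(** Scaling makes the values of [esym1] agree; then [sratio] fixes [esym2], and the equation of the
    curve fixes [esym3]. *)
Lemma cayley_pt_S3_inj l m : in_U l -> in_U m -> cayley_eq l -> cayley_eq m ->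
  esym1 l != 0 -> esym1 m != 0 -> sratio l = sratio m -> pt_S3 l = pt_S3 m.
Proof.
move=> ld md lc mc l0 m0 lm.
have [l2 l3] := cayley_esym lc l0; have [m2 m3] := cayley_esym mc m0.
pose k := esym1 l / esym1 m; have k0 : k != 0 by rewrite mulf_neq0 ?invr_eq0.
have [k1 k2 k3] := esymZ k m.
have kE : k * esym1 m = esym1 l by rewrite divfK.
have [||||s mE] := @esym_inj l (k *: m).
- exact: in_UZ.
- by rewrite k1 kE.
- by rewrite k2 m2 l2 lm -kE; ring.
- by rewrite k3 m3 l3 lm -kE; ring.
apply/pt_S3_eq; rewrite ?in_U_neq0 //; exists s, k^-1; rewrite invr_eq0; split=> //.
by rewrite -mE scalerA mulVf // scale1r.
Qed.

End CurveAlgebra.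

(** * The complex structure of the Cayley curve *)

Section CurveTopology.
Variable C : numClosedFieldType.
Implicit Types (l v : 'rV[C]_3).

Lemma open_nonzero : open [set v : 'rV[C]_3 | v != 0].
Proof.
rewrite (_ : [set v | _] = ~` [set 0]); last first.
  by apply/seteqP; split=> v /=; [move/eqP|move=> h; apply/eqP].
apply: closed_openC; apply: accessible_closed_set1.
by apply: hausdorff_accessible; exact: norm_hausdorff.
Qed.

(* [\pi] is locked, so that its instances for [Q] and [quotient_topology Q] are equal
   but not convertible. *)
Lemma open_quotientE (T : topologicalType) (Q : quotType T)
  (O : set (quotient_topology Q)) : open O <-> open (\pi_Q @^-1` O : set T).
Proof.
have -> : \pi_Q @^-1` O = \pi_(quotient_topology Q) @^-1` O :> set T.
  by apply/seteqP; split=> x; rewrite /preimage /= !unlock.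
by split=> h; exact: h.
Qed.

Lemma open_initialE (S : choiceType) (T : topologicalType) (f : S -> T)
  (O : set (initial_topology f)) : open O <-> exists2 U, open U & f @^-1` U = O.
Proof. by split=> -[U oU UO]; exists U. Qed.

Definition vec (v : 'rV[C]_3) : nonzero_vec [set: 'rV[C]_3] := insubd (pt100 C) v.

Lemma vec_val (w : nonzero_vec [set: 'rV[C]_3]) : vec (val w) = w.
Proof. exact: valKd. Qed.

Lemma val_neq0 (w : nonzero_vec [set: 'rV[C]_3]) : val w != 0.
Proof. by case: w => w /= /set_mem[]. Qed.

Definition vec_space : topologicalType :=
  initial_topology (val : nonzero_vec [set: 'rV[C]_3] -> 'rV[C]_3).

Lemma open_vecE (O : set vec_space) :
  open O <-> open [set v : 'rV[C]_3 | v != 0 /\ O (vec v)].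
Proof.
split=> [/open_initialE[U oU UE]|oO].
  rewrite (_ : [set v | _] = [set v | v != 0] `&` U); first exact: openI open_nonzero oU.
  by apply/seteqP; split=> v /= [v0 vO]; split=> //; move: vO;
    rewrite -UE /= val_insubd_pt100.
apply/open_initialE; exists [set v : 'rV[C]_3 | v != 0 /\ O (vec v)] => //.
apply/seteqP; split=> w /=; rewrite vec_val; first by case.
by move=> wO; split=> //; exact: val_neq0.
Qed.

Lemma open_CP2_S3E (O : set (CP2_S3_space C)) :
  open O <-> open ((fun w : nonzero_vec _ =>
      \pi_(CP2_S3 C) (\pi_(CP2 C) w)) @^-1` O : set vec_space).
Proof.
apply: (iff_trans (@open_quotientE (CP2_space C) (CP2_S3 C) O)).
exact: (@open_quotientE vec_space (CP2 C)).
Qed.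

(** Two quotient topologies and one induced topology collapse into a condition on non-zero vectors,
    the form used from here on. *)
Lemma open_pt_S3 (O : set (CP2_S3_space C)) :
  open O <-> open [set v : 'rV[C]_3 | v != 0 /\ O (pt_S3 v)].
Proof. exact: iff_trans (open_CP2_S3E O) (open_vecE _). Qed.

Lemma hol_pt_S3 (O : set (CP2_S3_space C)) (g : CP2_S3_space C -> C) v :
  open O -> hol O g -> v != 0 -> O (pt_S3 v) ->
  exists W (h : 'rV[C]_3 -> C^o), [/\ open W, W v, forall u, W u -> differentiable h u &
    forall u, W u -> g (pt_S3 u) = h u].
Proof.
move=> oO gO v0 vO.
have [|W [h [oW Wv hW gh]]] := gO (insubd (pt100 C) v); first by [].
exists (W `&` [set v | v != 0 /\ O (pt_S3 v)]), h; split.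
- by apply: openI => //; exact/open_pt_S3.
- by split=> //; move: Wv; rewrite val_insubd_pt100.
- by move=> u [Wu _]; exact: hW.
- move=> u [Wu [u0 uO]].
  have := gh (insubd (pt100 C) u); rewrite val_insubd_pt100 //; exact.
Qed.

Lemma pt_S3_hol (O : set (CP2_S3_space C)) (g : CP2_S3_space C -> C) (h : 'rV[C]_3 -> C^o) :
  open O -> (forall v, v != 0 -> O (pt_S3 v) -> differentiable h v /\ g (pt_S3 v) = h v) ->
  hol O g.
Proof.
move=> oO gh w wO; have qval z : pt_S3 (val z) = \pi_(CP2_S3 C) (\pi_(CP2 C) z).
  by rewrite /pt_S3 /pt -/(vec _) vec_val.
exists [set v : 'rV[C]_3 | v != 0 /\ O (pt_S3 v)], h; split.
- exact/open_pt_S3.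
- by split; [exact: val_neq0|rewrite qval].
- by move=> v [v0 vO]; have [] := gh v v0 vO.
- by move=> z zO [z0 zqO]; have [_ <-] := gh _ z0 zqO; rewrite qval.
Qed.

Definition curve_moduli (m : cayley_curve C) : CP2_S3_space C := moduli (set_val m).

Definition curve_coord (m : cayley_curve C) : affine_space C^o :=
  sratio (coords (repr (curve_moduli m : CP2_S3 C))).

Lemma open_curve (O : set (cayley_curve C)) :
  open O <-> exists2 U : set (CP2_S3_space C), open U & curve_moduli @^-1` U = O.
Proof.
split=> [[U1 [U2 oU2 <-] <-]|[U oU <-]]; first by exists U2.
by exists (@moduli C @^-1` U : set (MM_space C)) => //; exists U.
Qed.

(** Two open sets appear because the structure is induced in two steps: [f] extends locally to the
    moduli space, and that extension again to the quotient of the projective plane. *)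
Lemma hol_curve (W : set (cayley_curve C)) f m : hol W f -> W m ->
  exists (O1 O2 : set (CP2_S3_space C)) g,
    [/\ open O1 /\ open O2, O1 (curve_moduli m) /\ O2 (curve_moduli m), hol O2 g &
      forall n, W n -> O1 (curve_moduli n) -> O2 (curve_moduli n) -> f n = g (curve_moduli n)].
Proof.
move=> fW Wm; have [W1 [g1 [[U1 oU1 W1E] W1m g1W fg1]]] := fW m Wm.
have [U2 [g2 [oU2 U2m g2O g12]]] := g1W _ W1m.
exists U1, U2, g2; split=> //; first by split=> //; move: W1m; rewrite -W1E.
move=> n Wn O1n O2n; have W1n : W1 (set_val n) by rewrite -W1E.
by rewrite (fg1 n Wn W1n); exact: g12.
Qed.

Lemma curve_hol (W : set (cayley_curve C)) f (O : set (CP2_S3_space C)) g :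
  open O -> hol O g -> (forall m, W m -> O (curve_moduli m) /\ f m = g (curve_moduli m)) ->
  hol W f.
Proof.
move=> oO gO fg m Wm.
exists (@moduli C @^-1` O : set (MM_space C)), (g \o @moduli C); split.
- by exists O.
- by case: (fg m Wm).
- by move=> n nO; exists O, g; split.
- by move=> n Wn _; case: (fg n Wn).
Qed.

Lemma curveP (m : cayley_curve C) : exists l,
  [/\ in_U l /\ cayley_eq l, curve_moduli m = pt_S3 l, esym1 l != 0 &
   [/\ curve_coord m = sratio l, jbar_restr m = jpar (sratio l) & good (sratio l)]].
Proof.
have [l [l_dist ml mc mj]] := moduliP (set_val m).
have [/mc lc mS] : (@pi_cayley C `\` @SS C) (set_val m).
  exact: set_mem (valP (m : set_type (@pi_cayley C `\` @SS C))).
have j0 : jfun l != 0.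
  by apply/eqP => j0; apply: mS; left; split; [exact/mc|rewrite /= mj].
have j1728 : jfun l != 1728.
  by apply/eqP => j1; apply: mS; right; split; [exact/mc|rewrite /= mj].
have [e0 lT] := curve_good l_dist lc j0 j1728.
exists l; split=> //; split=> //.
  by rewrite /curve_coord /curve_moduli ml sratio_pt_S3 ?in_U_neq0.
by rewrite /jbar_restr mj; have [] := cayley_jfun l_dist lc e0.
Qed.

Lemma curve_coord_inj : injective curve_coord.
Proof.
move=> m n; have [l [[ld lc] ml l0 [-> _ _]]] := curveP m.
have [k [[kd kc] nk k0 [-> _ _]]] := curveP n => lk.
apply: val_inj; apply: moduli_inj; rewrite -[LHS]/(curve_moduli m) -[RHS]/(curve_moduli n).
by rewrite ml nk; exact: cayley_pt_S3_inj.
Qed.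

Lemma curve_point l s : good s -> esym1 l = 1 -> esym2 l = s -> esym3 l = s ^+ 2 / 4 ->
  exists m, curve_moduli m = pt_S3 l.
Proof.
move=> sT h1 h2 h3; have [ld lc l_sig j0 j1] := good_curve sT h1 h2 h3.
have [m ml] := moduli_surj ld.
have [k [kd mk mc mj]] := moduliP m.
have jm : jbar m = jfun l by rewrite /jbar ml jfun_pt_S3 // in_U_neq0.
have kc : cayley_eq k.
  have /pt_S3_eq[||s' [c [c0 ->]]] : pt_S3 l = pt_S3 k by rewrite -ml.
  - exact: in_U_neq0.
  - exact: in_U_neq0.
  apply/cayley_eqZ => //; rewrite /cayley_eq.
  by have [-> -> ->] := esym_perm s' l.
have mS : m \in @pi_cayley C `\` @SS C.
  apply/mem_set; split; first exact/mc.
  by rewrite /SS /S_ /= jm => -[[_ /eqP]|[_ /eqP]]; rewrite ?(negbTE j0) ?(negbTE j1).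
by exists (exist _ m mS).
Qed.

Lemma differentiable_sratio v : esym1 v != 0 -> differentiable (@sratio C : 'rV[C]_3 -> C^o) v.
Proof.
have dc i : differentiable (fun u : 'rV[C]_3 => u 0 i : C^o) v by exact: differentiable_coord.
move=> v0; apply: differentiable_div; last by rewrite expf_neq0.
  apply: (differentiable_add (f := fun u : 'rV[C]_3 => u 0 0 * u 0 1 + u 0 1 * u 0 2%:R)).
    by apply: (differentiable_add (f := fun u : 'rV[C]_3 => u 0 0 * u 0 1));
      exact: differentiable_mul.
  exact: differentiable_mul.
apply: (differentiable_exp (f := @esym1 C : 'rV[C]_3 -> C^o)).
apply: (differentiable_add (f := fun u : 'rV[C]_3 => u 0 0 + u 0 1)) => //.
exact: differentiable_add.
Qed.

Lemma continuous_esym1 : continuous (@esym1 C : 'rV[C]_3 -> C).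
Proof.
have dc i v : differentiable (fun u : 'rV[C]_3 => u 0 i : C^o) v by exact: differentiable_coord.
move=> v; apply: (differentiable_continuous (W := C^o)).
apply: (differentiable_add (f := fun u : 'rV[C]_3 => u 0 0 + u 0 1)) => //.
exact: differentiable_add.
Qed.

(** The condition on [esym1] excludes the points where the division in [sratio] returns the default
    value 0. *)
Definition sratio_dom (O : set C) : set (CP2_S3_space C) :=
  [set p | esym1 (coords (repr (p : CP2_S3 C))) != 0 /\
      O (sratio (coords (repr (p : CP2_S3 C))))].

Lemma sratio_dom_pt_S3 O v : v != 0 -> sratio_dom O (pt_S3 v) <-> esym1 v != 0 /\ O (sratio v).
Proof. by move=> v0; rewrite /sratio_dom /= esym1_pt_S3 // sratio_pt_S3. Qed.

Lemma open_sratio_dom (O : set C) : open O -> open (sratio_dom O).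
Proof.
move=> oO; apply/open_pt_S3; rewrite openE => v /= [v0 /(sratio_dom_pt_S3 _ v0)[e0 sO]].
have n0 : \forall u \near v, u != 0 by apply: open_nbhs_nbhs; split=> //; exact: open_nonzero.
have ne : \forall u \near v, esym1 u != 0.
  have := @cvgr_neq0 _ _ _ (nbhs v) _ (@esym1 C : _ -> C^o) _ (@continuous_esym1 v) e0; exact.
have ns : \forall u \near v, O (sratio u).
  have /differentiable_continuous := differentiable_sratio e0; apply.
  exact: open_nbhs_nbhs.
apply: filterS (filterI n0 (filterI ne ns)) => u [u0 [ue uO]].
by split=> //; apply/sratio_dom_pt_S3.
Qed.

Lemma curve_coord_dom (O : set C) : curve_moduli @^-1` sratio_dom O = curve_coord @^-1` O.
Proof.
apply/seteqP; split=> m; first by case.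
move=> mO; have [l [[ld _] ml l0 _]] := curveP m.
split=> //; by rewrite ml esym1_pt_S3 ?in_U_neq0.
Qed.

Lemma curve_coord_holomorphic : holomorphic_on setT curve_coord.
Proof.
split=> [V oV|V g oV gV]; rewrite setTI.
  by apply/open_curve; exists (sratio_dom V); [exact: open_sratio_dom|exact: curve_coord_dom].
apply: (@curve_hol _ _ (sratio_dom V) (fun p => g (sratio (coords (repr (p : CP2_S3 C)))))).
- exact: open_sratio_dom.
- apply: (@pt_S3_hol _ _ (g \o @sratio C : _ -> C^o)); first exact: open_sratio_dom.
  move=> v v0 /(sratio_dom_pt_S3 _ v0)[e0 sO]; split; last by rewrite sratio_pt_S3.
  apply: (@differentiable_comp _ _ C^o C^o); first exact: differentiable_sratio.
  exact: gV.
- by move=> m mO; split=> //;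
    rewrite -[_ (curve_moduli m)]/((curve_moduli @^-1` sratio_dom V) m) curve_coord_dom.
Qed.

End CurveTopology.

(** * The coordinate as a bijection onto its range, with holomorphic inverse *)

Section Covering.
Variable C : numClosedFieldType.

Section MonicPoly.
Variables (n : nat) (E : nat -> C).
Hypothesis En : E n = 1.
Let P := \poly_(i < n.+1) E i.

Lemma size_monic_poly : size P = n.+1.
Proof. by rewrite size_poly_eq //= En oner_eq0. Qed.

Lemma monic_poly_monic : P \is monic.
Proof. by rewrite monicE lead_coef_poly //= En ?oner_eq0. Qed.

Lemma monic_poly_roots : exists r : 'I_n -> C, P = \prod_(i < n) ('X - (r i)%:P).
Proof.
have [rs] := closed_field_poly_normal P.
rewrite (monicP monic_poly_monic) scale1r => Prs.
have srs : size rs = n by have := size_monic_poly; rewrite Prs size_prod_XsubC => -[].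
exists (fun i => rs`_i); rewrite Prs (big_nth 0) srs big_mkord.
by [].
Qed.
End MonicPoly.

Lemma horner_prod_ord3 (r : 'I_3 -> C) t :
  (\prod_(i < 3) ('X - (r i)%:P)).[t] = (t - r 0) * (t - r 1) * (t - r 2%:R).
Proof.
rewrite horner_prod !big_ord_recr big_ord0 /= mul1r !hornerXsubC.
by congr ((t - r _) * (t - r _) * (t - r _)); apply/val_inj.
Qed.

(* On the Cayley curve $e_3 = e_2^2 / 4$ when $e_1 = 1$. *)
Definition cubic_coef (s : C) (i : nat) : C := [:: - (s ^+ 2 / 4); s; -1; 1]`_i.
Definition cubic_poly (s : C) : {poly C} := \poly_(i < 4) cubic_coef s i.

Lemma cubic_poly_esym s (r : 'I_3 -> C) : cubic_poly s = \prod_(i < 3) ('X - (r i)%:P) ->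
  let l := \row_i r i in [/\ esym1 l = 1, esym2 l = s & esym3 l = s ^+ 2 / 4].
Proof.
move=> sr l.
have E t : t ^+ 3 - esym1 l * t ^+ 2 + esym2 l * t - esym3 l
    = t ^+ 3 - t ^+ 2 + s * t - s ^+ 2 / 4.
  rewrite -esym_roots !mxE -horner_prod_ord3 -sr horner_poly.
  by rewrite !big_ord_recr big_ord0 /= /cubic_coef /=; ring.
move: (esym1 l) (esym2 l) (esym3 l) E => e1 e2 e3 E.
(* The coefficients are separated by evaluation: [t = 0] gives [e3], the difference between [t = 1]
   and [t = -1] gives [e2], and [t = 1] then gives [e1]. *)
have h3 : e3 = s ^+ 2 / 4.
  by have := E 0; rewrite !expr0n /= !mulr0 !subr0 !add0r => /oppr_inj.
have two0 : (2 : C) != 0 by rewrite pnatr_eq0.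
have h2 : e2 = s.
  apply: (mulfI two0); apply/eqP; rewrite -subr_eq0; apply/eqP.
  have E1 := E 1; have E2 := E (-1); rewrite h3 in E1 E2.
  transitivity ((1 ^+ 3 - e1 * 1 ^+ 2 + e2 * 1 - s ^+ 2 / 4) - ((-1) ^+ 3 - e1 * (-1) ^+ 2 +
      e2 * (-1) - s ^+ 2 / 4)
    - ((1 ^+ 3 - 1 ^+ 2 + s * 1 - s ^+ 2 / 4) - ((-1) ^+ 3 - (-1) ^+ 2 + s * (-1) - s ^+ 2 / 4))).
    by ring.
  by rewrite E1 E2 subrr.
split=> //; have := E 1; rewrite h2 h3 => /eqP; rewrite -subr_eq0 => /eqP h.
by apply/eqP; rewrite -subr_eq0 -oppr_eq0 -h; apply/eqP; ring.
Qed.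

Lemma good_root_row s : good s ->
  exists2 r : 'I_3 -> C, injective r & cubic_poly s = \prod_(i < 3) ('X - (r i)%:P).
Proof.
move=> sT; have [|r sr] := @monic_poly_roots 3 (cubic_coef s); first by [].
exists r => //; have [h1 h2 h3] := cubic_poly_esym sr.
have [[_ r01 r12 r02] _ _ _ _] := good_curve sT h1 h2 h3.
rewrite !mxE in r01 r12 r02.
by move=> i j; case: (ord3E i) => ->; case: (ord3E j) => -> // /eqP;
  rewrite ?(negbTE r01) ?(negbTE r12) ?(negbTE r02) //
          eq_sym ?(negbTE r01) ?(negbTE r12) ?(negbTE r02).
Qed.

Lemma differentiable_row (f : 'I_3 -> C -> C^o) s : (forall i, differentiable (f i) s) ->
  differentiable (fun z => \row_i f i z : 'rV[C]_3) s.
Proof.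
move=> df; rewrite (_ : (fun z => _) = \sum_(i < 3) (fun z =>
    f i z *: (delta_mx 0 i : 'rV[C]_3))).
  by apply: differentiable_sum => i; exact: differentiableZl.
apply/funext => z; rewrite fct_sumE [LHS]row_sum_delta.
by apply: eq_bigr => i _; rewrite mxE.
Qed.

Lemma local_lift s0 : good s0 -> exists lam : C -> 'rV[C]_3,
  \forall s \near s0, [/\ differentiable lam s, esym1 (lam s) = 1,
    esym2 (lam s) = s & esym3 (lam s) = s ^+ 2 / 4].
Proof.
move=> /good_root_row[r r_inj sr].
have Pd : \forall s \near s0, forall k, differentiable (fun y => (cubic_poly y)`_k : C^o) s.
  apply: filterE => s k; rewrite (_ : (fun y => _) =
      (fun y => if (k < 4)%N then cubic_coef y k else 0 : C^o)); last first.
    by apply/funext => y; rewrite coef_poly.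
  have did := differentiable_idfun s.
  have dc a := differentiable_const a s.
  have d0 : differentiable (fun y : C => - (y ^+ 2 / 4) : C^o) s.
    rewrite (_ : (fun y => _) = (fun y : C => - 4^-1 * y ^+ 2 : C^o)).
      by apply: (differentiable_mul (f := fun=> - 4^-1)) => //; exact: differentiable_exp.
    by apply/funext => y; rewrite mulNr mulrC.
  by case: k => [|[|[|[|k]]]] /=; rewrite /cubic_coef /=;
    [exact: d0|exact: did|exact: dc|exact: dc|exact: dc].
have rr i : root (cubic_poly s0) (r i) by rewrite sr; apply/root_prod_ordP; exists i.
have [f _ [e _ fP]] := differentiable_roots (fun s =>
    monic_poly_monic (erefl : cubic_coef s 3 = 1))
  (fun s => size_monic_poly (erefl : cubic_coef s 3 = 1)) Pd r_inj rr.
exists (fun s => \row_i f i s); apply: filterS fP => s [sf _ df].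
by have [h1 h2 h3] := cubic_poly_esym sf; split=> //; exact: differentiable_row.
Qed.

Lemma open_good : open (@good C).
Proof.
rewrite openE => s sT.
have did := differentiable_idfun s.
have dc a := differentiable_const a s.
have cont : {for s, continuous (fun s : C => s * (8 - 27 * s) * ((1 - 3 * s) * qpol s) : C^o)}.
  apply: differentiable_continuous.
  have d2 (a b : C) : differentiable (fun s : C => a - b * s : C^o) s.
    apply: (differentiable_sub (f := fun=> a)); first exact: dc.
    by apply: (differentiable_mul (f := fun=> b)); [exact: dc|exact: did].
  apply: (differentiable_mul (f := fun s : C => s * (8 - 27 * s))).
    by apply: (differentiable_mul (f := fun s : C => s)); [exact: did|exact: d2].
  apply: (differentiable_mul (f := fun s : C => 1 - 3 * s)); first exact: d2.
  apply: (differentiable_add (f := fun s : C => 27 * s ^+ 2 - 36 * s)); last exact: dc.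
  apply: (differentiable_sub (f := fun s : C => 27 * s ^+ 2)).
    by apply: (differentiable_mul (f := fun=> 27)); [exact: dc|exact: differentiable_exp].
  by apply: (differentiable_mul (f := fun=> 36)); [exact: dc|exact: did].
have := @cvgr_neq0 _ _ _ (nbhs s) _ _ _ cont sT; exact.
Qed.

Lemma curve_coord_surj s : good s -> exists m : cayley_curve C, curve_coord m = s.
Proof.
move=> sT; have [r _ sr] := good_root_row sT; have [h1 h2 h3] := cubic_poly_esym sr.
have [m ml] := curve_point sT h1 h2 h3; exists m.
have [ld _ ls _ _] := good_curve sT h1 h2 h3.
by rewrite /curve_coord ml sratio_pt_S3 ?in_U_neq0.
Qed.

Lemma lift_moduli (m : cayley_curve C) l s : curve_coord m = s -> good s -> esym1 l = 1 ->
  esym2 l = s -> esym3 l = s ^+ 2 / 4 -> curve_moduli m = pt_S3 l.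
Proof.
move=> ms sT h1 h2 h3; have [n nl] := curve_point sT h1 h2 h3.
have [ld _ ls _ _] := good_curve sT h1 h2 h3.
rewrite -nl; congr curve_moduli; apply: curve_coord_inj.
by rewrite ms /curve_coord nl sratio_pt_S3 ?in_U_neq0.
Qed.

Lemma near_lam (U : set (CP2_S3_space C)) (lam : C -> 'rV[C]_3) s0 :
  differentiable lam s0 -> lam s0 != 0 -> open U -> U (pt_S3 (lam s0)) ->
  \forall s \near s0, lam s != 0 /\ U (pt_S3 (lam s)).
Proof.
move=> dlam l0 oU Us.
have nb : nbhs (lam s0) [set v | v != 0 /\ U (pt_S3 v)].
  by apply: open_nbhs_nbhs; split; [exact: (open_pt_S3 U).1 oU|split].
exact: (differentiable_continuous dlam nb).
Qed.

(** Ordered roots of the cubic lift [tau] to vectors only locally; by injectivity of [curve_coord]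
    every such lift represents the same points as the global [tau]. *)
Lemma section_holomorphic (tau : affine_space C^o -> cayley_curve C) :
  (forall s, good s -> curve_coord (tau s) = s) ->
      @holomorphic_on C (affine_space C^o) (cayley_curve C) (@good C) tau.
Proof.
move=> tauP.
have lift s0 : good s0 -> exists2 lam : C -> 'rV[C]_3, differentiable lam s0 &
    \forall s \near s0, [/\ good s, lam s != 0 & curve_moduli (tau s) = pt_S3 (lam s)].
  move=> sT; have [lam lamP] := local_lift sT; exists lam.
    by case: (nbhs_singleton lamP).
  have near_good : \forall s \near s0, good s by apply: open_nbhs_nbhs; split=> //;
      exact: open_good.
  apply: filterS (filterI near_good lamP) => s [gs [_ h1 h2 h3]].
  have [ld _ _ _ _] := good_curve gs h1 h2 h3.
  by split=> //; [exact: in_U_neq0|exact: lift_moduli (tauP s gs) gs h1 h2 h3].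
split=> [V /open_curve[U oU <-]|V g oV gV].
  rewrite openE => s0 [sT sU]; have [lam dlam lamP] := lift s0 sT.
  have [_ l0 ml0] := nbhs_singleton lamP.
  have near_U : \forall s \near s0, lam s != 0 /\ U (pt_S3 (lam s)).
    by apply: near_lam => //; rewrite -ml0.
  have near_tU : \forall s \near s0, good s /\ U (curve_moduli (tau s)).
    apply: filterS (filterI lamP near_U) => s [[gs _ ms] [_ sU']].
    by rewrite ms.
  exact: near_tU.
move=> s0 [sT sV]; have [lam dlam lamP] := lift s0 sT.
have [_ l0 ml0] := nbhs_singleton lamP.
have [U1 [U2 [h [[oU1 oU2] [U1s U2s] hU gh]]]] := hol_curve gV sV.
have [|W [k [oW Wl dk hk]]] := @hol_pt_S3 _ U2 h (lam s0) oU2 hU l0; first by rewrite -ml0.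
have /open_curve[U3 oU3 VE] := oV.
(* [h] agrees with [g] over [U1] and [U2], [U3] cuts out [V] on the curve, and [k] represents [h] on
   the set of vectors [W]. *)
have near_all : \forall s \near s0, (lam s != 0 /\ U1 (pt_S3 (lam s))) /\ (lam s != 0 /\
    U2 (pt_S3 (lam s))) /\
    (lam s != 0 /\ U3 (pt_S3 (lam s))) /\ W (lam s).
  have nW : \forall s \near s0, W (lam s).
    have nb : nbhs (lam s0) W by exact: open_nbhs_nbhs.
    exact: (differentiable_continuous dlam nb).
  have s3 : U3 (pt_S3 (lam s0)) by rewrite -ml0; move: sV; rewrite /= -VE.
  rewrite ml0 in U1s U2s.
  exact: filterI (near_lam dlam l0 oU1 U1s) (filterI (near_lam dlam l0 oU2 U2s)
    (filterI (near_lam dlam l0 oU3 s3) nW)).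
have near_eq : \forall s \near s0, (k \o lam) s = (g \o tau) s.
  apply: filterS (filterI lamP near_all) => s [[gs ls ms] [[_ s1] [[_ s2] [[_ s3] sW]]]].
  rewrite /= -hk // -ms; apply/esym/gh; rewrite ?ms //.
  by rewrite -VE /= ms.
apply/derivable1_diffP; apply: (near_eq_derivable near_eq); apply/derivable1_diffP.
apply: (@differentiable_comp _ _ _ C^o) => //; exact: dk.
Qed.

End Covering.

(** * The covering *)

Section Final.
Variable C : numClosedFieldType.

(* The coefficients of $4096 (1 - 3 X)^3 - y X^3 (8 - 27 X)$ divided by $27 y$. *)
Definition quartic_coef (y : C) (i : nat) : C :=
  [:: 4096 / (27 * y); - (4096 * 9) / (27 * y); (4096 * 27) / (27 * y);
      (- 8 * y - (4096 * 27)) / (27 * y); 1]`_i.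
Definition quartic (y : C) : {poly C} := \poly_(i < 5) quartic_coef y i.

(** True for [y = 0] as well, where the divisions return 0 but the leading coefficient stays 1;
    [differentiable_roots] asks for it at every [y]. *)
Let quartic_monic y : quartic y \is monic.
Proof. exact: (monic_poly_monic (erefl : quartic_coef y 4 = 1)). Qed.

Let size_quartic y : size (quartic y) = 5.
Proof. exact: (size_monic_poly (erefl : quartic_coef y 4 = 1)). Qed.

Lemma horner_quartic y x : y != 0 -> 27 * y * (quartic y).[x] =
  4096 * (1 - 3 * x) ^+ 3 - y * (x ^+ 3 * (8 - 27 * x)).
Proof.
move=> y0; rewrite horner_poly !big_ord_recr big_ord0 /= /quartic_coef /=; field.
by [].
Qed.

Lemma horner_deriv_quartic y x : y != 0 -> 27 * y * (quartic y)^`().[x] =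
  - (4096 * 9) * (1 - 3 * x) ^+ 2 - y * (12 * x ^+ 2 * (2 - 9 * x)).
Proof.
move=> y0; rewrite (@horner_coef_wide _ 4); last first.
  have : (size (quartic y)^`() < size (quartic y))%N.
    by apply: lt_size_deriv; rewrite -size_poly_eq0 size_quartic.
  by rewrite size_quartic.
rewrite !big_ord_recr big_ord0 /= !coef_deriv !coef_poly /= /quartic_coef /=; field.
by [].
Qed.

Lemma quartic_rootP y x : y != 0 ->
  root (quartic y) x <-> x * (8 - 27 * x) != 0 /\ jpar x = y.
Proof.
move=> y0; have y27 : 27 * y != 0 by rewrite mulf_neq0 ?pnatr_eq0.
have -> : root (quartic y) x = (4096 * (1 - 3 * x) ^+ 3 == y * (x ^+ 3 * (8 - 27 * x))).
  by rewrite -subr_eq0 -horner_quartic // mulf_eq0 (negbTE y27).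
split=> [/eqP h|[+ <-]].
  have x0 : x != 0.
    apply/eqP => x0; move: h; rewrite x0 expr0n /= !(mul0r, mulr0) subr0 expr1n mulr1.
    by move/eqP; rewrite pnatr_eq0.
  have x8 : 8 - 27 * x != 0.
    apply/eqP => x8; have x27 : 27 * x = 8 by apply/esym/eqP; rewrite -subr_eq0 x8.
    (* At [x = 8/27] one has [1 - 3 x = 1/9]; the factor [9 ^+ 3] clears the fraction and shows that
       this pole of [jpar] is not a root. *)
    have : 9 ^+ 3 * (4096 * (1 - 3 * x) ^+ 3) = 4096 :> C.
      have -> : 9 ^+ 3 * (4096 * (1 - 3 * x) ^+ 3) = 4096 * (9 - 27 * x) ^+ 3 by ring.
      by rewrite x27; ring.
    by rewrite h x8 !mulr0 => /esym/eqP; rewrite pnatr_eq0.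
  by split; [rewrite mulf_neq0|rewrite /jpar h mulfK // mulf_neq0 ?expf_neq0].
rewrite mulf_eq0 negb_or => /andP[x0 x8].
by rewrite /jpar divfK // mulf_neq0 ?expf_neq0.
Qed.

Lemma quartic_simple y x : y != 0 -> y != 1728 -> root (quartic y) x ->
  (quartic y)^`().[x] != 0.
Proof.
move=> y0 y1 /(quartic_rootP _ y0)[x8 jx]; apply/negP => /eqP d0.
have : good x by apply/goodP => //; rewrite jx.
rewrite /good /= mulf_eq0 (negbTE x8) /= => /negP; apply; apply/eqP.
have := horner_deriv_quartic x y0; rewrite d0 mulr0 => h.
have yx : y * (x ^+ 3 * (8 - 27 * x)) = 4096 * (1 - 3 * x) ^+ 3.
  move: x8; rewrite -jx /jpar mulf_eq0 negb_or => /andP[x0 x8].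
  by rewrite divfK // mulf_neq0 ?expf_neq0.
(* Eliminating [y] between the quartic and its derivative leaves, up to a constant, the numerator of
   the derivative of [jpar]; its factors vanish only over the values 0 and 1728. *)
have E : (4096 * 3) * ((1 - 3 * x) ^+ 2 * qpol x) = 0.
  have -> : (4096 * 3) * ((1 - 3 * x) ^+ 2 * qpol x) =
      - ((- (4096 * 9) * (1 - 3 * x) ^+ 2 - y * (12 * x ^+ 2 * (2 - 9 * x))) * (x * (8 - 27 * x)))
      - 12 * (2 - 9 * x) * (y * (x ^+ 3 * (8 - 27 * x)) - 4096 * (1 - 3 * x) ^+ 3).
    by rewrite /qpol; ring.
  by rewrite -h yx subrr mul0r oppr0 mulr0 subr0.
move/eqP: E; rewrite mulf_eq0 mulf_eq0 !pnatr_eq0 /= mulf_eq0 expf_eq0 /= => /orP[]/eqP->;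
  by rewrite ?mul0r ?mulr0.
Qed.

Lemma quartic_roots y : y != 0 -> y != 1728 ->
  exists2 r : 'I_4 -> C, injective r & forall i, root (quartic y) (r i).
Proof.
move=> y0 y1; have [|r yr] := @monic_poly_roots C 4 (quartic_coef y); first by [].
exists r; last by move=> i; rewrite [quartic y]yr; apply/root_prod_ordP; exists i.
have : separable_poly (\prod_(z <- [seq r i | i <- enum 'I_4]) ('X - z%:P)).
  rewrite big_map big_enum /= -yr -/(quartic y) unlock;
      apply: Pdiv.ClosedField.root_coprimep => x.
  exact: quartic_simple.
rewrite separable_prod_XsubC => /injectiveP; exact.
Qed.

Lemma differentiable_quartic_coef y k : y != 0 ->
  differentiable (fun z => (quartic z)`_k : C^o) y.
Proof.
move=> y0; rewrite (_ : (fun z => _) = (fun z =>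
    if (k < 5)%N then quartic_coef z k else 0 : C^o)); last first.
  by apply/funext => z; rewrite coef_poly.
have did := differentiable_idfun y.
have dc a := differentiable_const a y.
have dm (a : C) : differentiable (fun z : C => a * z : C^o) y.
  by apply: (differentiable_mul (f := fun=> a)); [exact: dc|exact: did].
have dq (f : C -> C^o) : differentiable f y -> differentiable (fun z : C =>
    f z / (27 * z) : C^o) y.
  by move=> df; apply: (differentiable_div df (dm 27)); rewrite mulf_neq0 ?pnatr_eq0.
have d8 : differentiable (fun z : C => - 8 * z - (4096 * 27) : C^o) y.
  exact: differentiable_sub (dm (- 8)) (dc (4096 * 27)).
by case: k => [|[|[|[|[|k]]]]] /=; rewrite /quartic_coef /=;
  [exact: (dq (fun=> 4096))|exact: (dq (fun=> - (4096 * 9)))|exact: (dq (fun=> (4096 * 27)))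
  |exact: dq d8|exact: dc|exact: dc].
Qed.

(** In a [holSpace] the predicate [hol] is arbitrary, so restriction needs a proof; for induced
    structures it holds because the condition is local. *)
Lemma induced_hol_sub (X : choiceType) (Y : holSpace C) (i : X -> Y)
  (W W0 : set (induced_space i)) f : W0 `<=` W -> hol W f -> hol W0 f.
Proof.
move=> W0W fW x /W0W/fW[V [g [oV Vx gV fg]]]; exists V, g; split=> // y /W0W; exact: fg.
Qed.

Lemma jpar_differentiable s : good s -> differentiable (@jpar C : C -> C^o) s.
Proof.
rewrite /good /= mulf_eq0 mulf_eq0 !negb_or => /andP[/andP[s0 s8] _].
have did := differentiable_idfun s.
have dc a := differentiable_const a s.
have dl (a b : C) : differentiable (fun z : C => a - b * z : C^o) s.
  exact: differentiable_sub (dc a) (differentiable_mul (dc b) did).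
apply: (differentiable_div (f := fun z : C => 4096 * (1 - 3 * z) ^+ 3 : C^o)
  (g := fun z : C => z ^+ 3 * (8 - 27 * z) : C^o)).
- exact: differentiable_mul (dc 4096) (differentiable_exp (dl 1 3) 3).
- exact: differentiable_mul (differentiable_exp did 3) (dl 8 27).
- by rewrite mulf_neq0 ?expf_neq0.
Qed.

Lemma jbar_restrE (m : cayley_curve C) : jbar_restr m = jpar (curve_coord m) /\
    good (curve_coord m).
Proof. by have [l [_ _ _ [-> -> ?]]] := curveP m. Qed.

Lemma holomorphic_on_comp (X Y Z : holSpace C) (W : set X) (V : set Y) (f : X -> Y) (g : Y -> Z) :
  set_fun W V f -> holomorphic_on W f -> holomorphic_on V g -> holomorphic_on W (g \o f).
Proof.
move=> WV [fo fh] [go gh].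
have E U : W `&` (g \o f) @^-1` U = W `&` f @^-1` (V `&` g @^-1` U).
  by apply/seteqP; split=> x [Wx]; [split=> //; split=> //; exact: WV|case].
split=> [U oU|U h oU hU]; rewrite E; first exact/fo/go.
exact: (fh _ (h \o g) (go _ oU) (gh _ _ oU hU)).
Qed.

Lemma differentiable_holomorphic_on (W : set C) (f : C -> C) : open W ->
  (forall x, W x -> differentiable (f : C -> C^o) x) ->
  @holomorphic_on C (affine_space C^o) (affine_space C^o) W f.
Proof.
move=> oW df; split=> [V oV|V g oV gV].
  rewrite openE => x [Wx Vfx].
  have nW : \forall z \near x, W z by exact: open_nbhs_nbhs.
  have nV : nbhs (f x) V by exact: open_nbhs_nbhs.
  exact: filterI nW (differentiable_continuous (df x Wx) nV).
move=> x [Wx Vfx]; apply: (@differentiable_comp _ _ C^o C^o); first exact: df.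
exact: gV.
Qed.

Lemma jbar_restr_holomorphic : holomorphic_on setT (@jbar_restr C).
Proof.
have -> : @jbar_restr C = (@jpar C : affine_space C^o -> affine_space C^o) \o @curve_coord C.
  by apply/funext => m; have [->] := jbar_restrE m.
apply: (holomorphic_on_comp (V := @good C : set (affine_space C^o))).
- by move=> m _; have [] := jbar_restrE m.
- exact: curve_coord_holomorphic.
- apply: differentiable_holomorphic_on; [exact: open_good|exact: jpar_differentiable].
Qed.

Lemma holomorphic_on_sub (X : choiceType) (Y Z : holSpace C) (i : X -> Y)
  (W : set (induced_space i)) (f : induced_space i -> Z) :
  open W -> holomorphic_on setT f -> holomorphic_on W f.
Proof.
move=> oW [fo fh]; split=> [V oV|V g oV gV].
  by apply: openI => //; rewrite -[f @^-1` V]setTI; exact: fo.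
by apply: induced_hol_sub (fh V g oV gV) => x [].
Qed.

Lemma nbhs_open_sub (T : topologicalType) (x : T) (G : set T) : nbhs x G ->
  exists V, [/\ open V, V x & V `<=` G].
Proof.
by move=> xG; exists G°; split; [exact: open_interior|exact: xG|exact: interior_subset].
Qed.

Definition jvalues : set C := ~` [set 0; 1728].

Lemma jvaluesP y : jvalues y <-> y != 0 /\ y != 1728.
Proof.
rewrite /jvalues /setC /=; split=> [h|[y0 y1] [h|h]].
- by split; apply/eqP => yE; apply: h; [left|right].
- by rewrite h eqxx in y0.
- by rewrite h eqxx in y1.
Qed.

Lemma open_jvalues : open (jvalues : set (affine_space C^o)).
Proof.
have cl (a : C) : closed [set a : C^o].
  by apply: accessible_closed_set1; apply: hausdorff_accessible; exact: norm_hausdorff.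
by apply: closed_openC; apply: closedU; exact: cl.
Qed.

Lemma quartic_curve (m : cayley_curve C) y : jvalues y -> jbar_restr m = y ->
  root (quartic y) (curve_coord m).
Proof.
move=> /jvaluesP[y0 y1] my; have [mj mg] := jbar_restrE m.
apply/quartic_rootP => //; split; last by rewrite -mj.
by move: mg; rewrite /good /= mulf_eq0 negb_or => /andP[].
Qed.

Lemma quartic_good y x : jvalues y -> root (quartic y) x -> good x /\ jpar x = y.
Proof.
move=> /jvaluesP[y0 y1] /(quartic_rootP _ y0)[x8 jx]; split=> //.
by apply/goodP => //; rewrite jx.
Qed.

Lemma jbar_covering : @holomorphic_covering C (cayley_curve C) (affine_space C^o)
    jvalues (@jbar_restr C) 4.
Proof.
have jB m : jvalues (@jbar_restr C m).
  by apply/jvaluesP; have [-> mg] := jbar_restrE m; apply/goodP => //;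
     move: mg; rewrite /good /= mulf_eq0 negb_or => /andP[].
split; [exact: open_jvalues|exact: jB|exact: jbar_restr_holomorphic|].
move=> y0 y0B; have [y00 y01] := (jvaluesP y0).1 y0B.
have [tau tauP] : exists tau : C -> cayley_curve C, forall s, good s -> curve_coord (tau s) = s.
  (* 2 is an arbitrary admissible parameter; the point over it serves as the value of [tau] outside
     [good]. *)
  have g2 : good (2 : C).
    rewrite /good /= /qpol (_ : _ * _ = 20240); last by ring.
    by rewrite pnatr_eq0.
  have [m0 _] := curve_coord_surj g2.
  have /choice[tau tauP] : forall s, exists m : cayley_curve C, good s -> curve_coord m = s.
    move=> s; have [sg|sg] := pselect (good s); last by exists m0.
    by have [m ms] := curve_coord_surj sg; exists m.
  by exists tau.
have [r r_inj rr] := quartic_roots y00 y01.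
have near_coef : \forall y \near y0, forall k, differentiable (fun z => (quartic z)`_k : C^o) y.
  have nB : \forall y \near y0, jvalues y by apply: open_nbhs_nbhs; split; [exact: open_jvalues|].
  by apply: filterS nB => y /jvaluesP[? _] k; exact: differentiable_quartic_coef.
have [s _ [e re near_s]] := differentiable_roots quartic_monic size_quartic near_coef r_inj rr.
have nB : \forall y \near y0, jvalues y by apply: open_nbhs_nbhs; split; [exact: open_jvalues|].
have [V [oV Vy0 VP]] := nbhs_open_sub (filterI near_s nB).
have VB y : V y -> jvalues y by move=> /VP[].
have sP y i : V y -> root (quartic y) (s i y).
  by move=> /VP[[-> _ _] _]; apply/root_prod_ordP; exists i.
have s_r y i : V y -> `|s i y - r i| < e by move=> /VP[[_ + _] _]; apply.
have sdiff y i : V y -> differentiable (s i) y by move=> /VP[[_ _ +] _]; apply.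
have rootE y x : V y -> root (quartic y) x -> exists i, x = s i y.
  by move=> /VP[[-> _ _] _] /root_prod_ordP.
pose Ball k : set C := [set x | `|x - r k| < e].
(* A sheet consists of the points over [V] whose coordinate lies in the ball of [r k]; the balls are
   disjoint, hence so are the sheets. *)
pose W k : set (cayley_curve C) := @jbar_restr C @^-1` V `&` @curve_coord C @^-1` Ball k.
have WP k m : W k m -> curve_coord m = s k (jbar_restr m).
  move=> [Vm mk]; have [i mi] := rootE _ _ Vm (quartic_curve (VB _ Vm) erefl).
  suff -> : k = i by [].
  by apply: (re _ _ (curve_coord m)) => //; rewrite mi; exact: s_r.
have oW k : open (W k).
  apply: openI.
    by rewrite -[_ @^-1` _]setTI; exact: jbar_restr_holomorphic.1.
  rewrite -[_ @^-1` _]setTI; apply: (@curve_coord_holomorphic C).1.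
  rewrite openE => x xk; have dist : {for x, continuous (fun z : C => z - r k)}.
    by apply: (@cvgB _ _ _ (nbhs x)); [exact: cvg_id|exact: cvg_cst].
  have xd : 0 < e - `|x - r k| by rewrite subr_gt0.
  have nx : \forall z \near x, `|(z - r k) - (x - r k)| < e - `|x - r k|.
    exact: cvgr_distC_lt _ _ dist _ xd.
  apply: filterS nx => z zx; rewrite /Ball /=.
  rewrite (_ : z - r k = ((z - r k) - (x - r k)) + (x - r k)); last by rewrite subrK.
  by rewrite (le_lt_trans (ler_normD _ _)) // -ltrBrDr.
exists V, W; split=> //.
- split=> // k1 k2 _ _ [m [[_ h1] [_ h2]]].
  exact: re h1 h2.
- apply/seteqP; split=> m; last by case=> k _ [].
  move=> Vm; have [i mi] := rootE _ _ Vm (quartic_curve (VB _ Vm) erefl).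
  by exists i => //; split=> //; rewrite /Ball /= mi; exact: s_r.
(* On this sheet the coordinate of a point is [s k] of its value, so the inverse sends [y] to the
   point of coordinate [s k y]. *)
move=> k; exists (tau \o s k).
have tauV y : V y -> curve_coord (tau (s k y)) = s k y /\ jbar_restr (tau (s k y)) = y.
  move=> Vy; have [sg sj] := quartic_good (VB _ Vy) (sP _ k Vy).
  by have [-> _] := jbar_restrE (tau (s k y)); rewrite tauP.
split.
- by move=> m [].
- move=> y Vy; have [h1 h2] := tauV y Vy; split; rewrite /= ?h2 //.
  by rewrite /Ball /= h1; exact: s_r.
- split=> [m /set_mem Wm|y /set_mem Vy]; last by have [] := tauV y Vy.
  apply: curve_coord_inj => /=; have [-> _] := tauV _ Wm.1.
  by rewrite (WP _ _ Wm).
- exact: holomorphic_on_sub (oW k) jbar_restr_holomorphic.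
- apply: (holomorphic_on_comp (V := @good C : set (affine_space C^o)) (f :=
    s k : affine_space C^o -> affine_space C^o)).
  + by move=> y Vy; have [] := quartic_good (VB _ Vy) (sP _ k Vy).
  + by apply: differentiable_holomorphic_on => // y Vy; exact: sdiff.
  + exact: section_holomorphic.
Qed.

End Final.
Theorem proposition6 (R : realType) :
  @holomorphic_covering R[i] (cayley_curve R[i]) (affine_space R[i]^o)
    (~` [set 0; 1728]) (@jbar_restr R[i]) 4.
Proof. exact: jbar_covering. Qed.
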